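(* Let $H\subset\mathbb{R}^d$ be a half-space, let $\Omega\subset H$ be open and bounded, and let $c:\Omega\to\mathbb{R}$ be bounded. Then there exist $p\ge1$ and $C>0$, depending only on $\Psi$ and the diameter of $\Omega$ (and $d$), such that if $u\in C_b(\mathbb{R}^d)$ is an anti-symmetric (with respect to $H$) viscosity super-solution of $$\Psi(-\Delta)u+c(x)u=0\quad\text{in }\Omega,$$ with $u\ge0$ on $H\setminus\Omega$, then $$\sup_{\Omega}u^-\le C\,\|c^-\|_{L^\infty(\Omega)}\,\|u^-\|_{L^p(\Omega)}.$$ In particular, given $c_\infty>0$ such that $c^-\le c_\infty$ on $\Omega$, there is $\delta>0$ such that if $|\Omega|<\delta$, then $u\ge0$ in $\Omega$.
   Context: Fix $d\ge 2$. $\Psi:(0,\infty)\to[0,\infty)$ is a Bernstein function, i.e. $\Psi\in C^\infty((0,\infty))$, $\Psi\ge 0$, $(-1)^n\Psi^{(n)}\le 0$ for all $n\ge1$, with $\lim_{x\downarrow 0}\Psi(x)=0$. Let $\mathfrak m$ be the unique measure on $(0,\infty)$ with $\Psi(\lambda)=\int_{(0,\infty)}(1-e^{-\lambda t})\,\mathfrak m(dt)$, and let $j(r)=\int_0^\infty(4\pi t)^{-d/2}e^{-r^2/(4t)}\,\mathfrak m(dt)$, $r>0$. Standing assumptions: (i) there are $0<a_1\le a_2<1\le b_1$ with $\frac1{b_1}(R/r)^{a_1}\le \Psi(R)/\Psi(r)\le b_1(R/r)^{a_2}$ for $1\le r\le R$; (ii) there is $b_2>1$ with $j(r)\le b_2\,j(r+1)$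 for $r\ge1$. Operator: $\Psi(-\Delta)f(x)=-\frac12\int_{\mathbb{R}^d}(f(x+z)+f(x-z)-2f(x))\,j(|z|)\,dz$ for bounded continuous $f$ that is $C^2$ near $x$. Half-space: $H=\{x\in\mathbb{R}^d: x\cdot e>\lambda\}$ with $|e|=1$, $\lambda\in\mathbb{R}$; $R(x)=x-2(x\cdot e)e+2\lambda e$ is the reflection at $\partial H$. A function $u:\mathbb{R}^d\to\mathbb{R}$ is anti-symmetric (w.r.t. $H$) if $u=-u\circ R$ on $\mathbb{R}^d$. $C_b(\mathbb{R}^d)$ is the set of bounded continuous functions; $u^-=\max(-u,0)$, $c^-=\max(-c,0)$; $|\Omega|$ is Lebesgue measure. Viscosity super-solution: $u\in C_b(\mathbb{R}^d)$ is a super-solution of $\Psi(-\Delta)u+c(x)u=0$ in $\Omega$ if for every $x\in\Omega$ and every bounded continuous $\varphi$ that is $C^2$ near $x$ with $\varphi(x)=u(x)$ and $\varphi<u$ on $\mathbb{R}^d\setminus\{x\}$, one has $\Psi(-\Delta)\varphi(x)+c(x)u(x)\ge0$.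
   Formalization: The norm of c^- on Omega is taken as the pointwise supremum rather than the essential supremum, since changing c on a null set affects viscosity super-solutions and the estimate with the essential supremum is false; the two agree for continuous c. *)

(* Defs.v *)
From HB Require Import structures.
From mathcomp Require Import all_boot all_order all_algebra.
From mathcomp Require Import all_classical all_reals all_analysis.

Set Implicit Arguments.
Unset Strict Implicit.
Unset Printing Implicit Defensive.

Import Order.TTheory GRing.Theory Num.Theory.
Import numFieldNormedType.Exports.

Local Open Scope classical_set_scope.
Local Open Scope ring_scope.

(* This is the Borel sigma-algebra of R^n. *)
Section measurable_rV.
Context {R : realType} (n : nat).

Definition rV_coord : 'I_n -> 'rV[R]_n -> R := fun i x => x ord0 i.

Let rV_set0 : g_sigma_preimage rV_coord set0.
Proof. exact: sigma_algebra0. Qed.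

Let rV_setC A : g_sigma_preimage rV_coord A -> g_sigma_preimage rV_coord (~` A).
Proof. exact: sigma_algebraC. Qed.

Let rV_bigcup (F : (set 'rV[R]_n)^nat) :
  (forall i, g_sigma_preimage rV_coord (F i)) ->
  g_sigma_preimage rV_coord (\bigcup_i F i).
Proof. exact: sigma_algebra_bigcup. Qed.

HB.instance Definition _ := @isMeasurable.Build
  (measure_tuple_display default_measure_display)
  'rV[R]_n (g_sigma_preimage rV_coord) rV_set0 rV_setC rV_bigcup.

End measurable_rV.

Lemma measurable_rV_coord {R : realType} n (i : 'I_n) :
  measurable_fun [set: 'rV[R]_n] (rV_coord i).
Proof.
move=> _ Y mY; rewrite setTI; apply: sub_sigma_algebra => /=.
rewrite -bigcup_seq/=; exists i => /=; first by rewrite mem_index_enum.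
by exists Y => //; rewrite setTI.
Qed.

Lemma measurable_fun_rVP {R : realType} d (T : measurableType d) n
    (f : T -> 'rV[R]_n) :
  measurable_fun [set: T] f <->
  forall i, measurable_fun [set: T] (rV_coord i \o f).
Proof.
split=> [mf i|mf].
  by apply: measurableT_comp => //; exact: measurable_rV_coord.
apply: (@measurability _ _ _ _ _ _
  (\big[setU/set0]_(i < n) preimage_set_system setT (@rV_coord R n i) measurable)).
  by [].
move=> _ [C hC <-]; move: hC; rewrite -bigcup_seq/= => -[i _ [B mB <-]].
by rewrite !setTI -comp_preimage -[X in measurable X]setTI; exact: mf.
Qed.

Lemma sigma_finite_product_measure {R : realType} d1 d2
    (T1 : measurableType d1) (T2 : measurableType d2)
    (m1 : {sigma_finite_measure set T1 -> \bar R})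
    (m2 : {sigma_finite_measure set T2 -> \bar R}) :
  sigma_finite setT (m1 \x m2)%E.
Proof.
have /sigma_finiteP[F [TF ndF Foo]] := sigma_finiteT m1.
have /sigma_finiteP[G [TG ndG Goo]] := sigma_finiteT m2.
exists (fun n => F n `*` G n).
  rewrite -setXTT TF TG predeqE => -[x y]; split.
    move=> [/= [n _ Fnx] [k _ Gky]]; exists (maxn n k) => //; split.
    - by move: x Fnx; exact/subsetPset/ndF/leq_maxl.
    - by move: y Gky; exact/subsetPset/ndG/leq_maxr.
  by move=> [n _ []/= ? ?]; split; exists n.
move=> k; have [? ?] := Foo k; have [? ?] := Goo k.
split; first exact: measurableX.
by rewrite product_measure1E// lte_mul_pinfty// ge0_fin_numE.
Qed.

Section lebesgue_rV.
Context {R : realType}.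

Definition rV_cons n (p : R * 'rV[R]_n) : 'rV[R]_n.+1 :=
  row_mx (const_mx p.1 : 'rV_1) p.2.

Definition rV_uncons n (x : 'rV[R]_n.+1) : R * 'rV[R]_n :=
  (x ord0 ord0, \row_(j < n) x ord0 (lift ord0 j)).

Lemma rV_cons0 n (p : R * 'rV[R]_n) : rV_cons p ord0 ord0 = p.1.
Proof.
by rewrite /rV_cons mxE; case: splitP => // j _; rewrite mxE.
Qed.

Lemma rV_consS n (p : R * 'rV[R]_n) j :
  rV_cons p ord0 (lift ord0 j) = p.2 ord0 j.
Proof.
rewrite /rV_cons mxE; case: splitP => [k /= jk|k /= [jk]].
  by have := ltn_ord k; rewrite -jk.
by congr (p.2 _ _); apply/val_inj.
Qed.

Lemma rV_consK n : cancel (@rV_cons n) (@rV_uncons n).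
Proof.
move=> [a y]; rewrite /rV_uncons rV_cons0; congr pair.
by apply/rowP => j; rewrite mxE rV_consS.
Qed.

Lemma rV_unconsK n : cancel (@rV_uncons n) (@rV_cons n).
Proof.
move=> x; apply/rowP => i; case: (unliftP ord0 i) => [j ->|->].
  by rewrite rV_consS mxE.
by rewrite rV_cons0.
Qed.

Lemma measurable_rV_cons n : measurable_fun setT (@rV_cons n).
Proof.
apply/measurable_fun_rVP => i; case: (unliftP ord0 i) => [j ->|->].
  rewrite (_ : _ \o _ = rV_coord j \o snd).
    by apply: measurableT_comp => //; exact: measurable_rV_coord.
  by apply/funext => p; exact: rV_consS.
rewrite (_ : _ \o _ = fst) //.
by apply/funext => p; exact: rV_cons0.
Qed.

Lemma measurable_rV_uncons n : measurable_fun setT (@rV_uncons n).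
Proof.
apply: measurable_fun_pair; first exact: measurable_rV_coord.
apply/measurable_fun_rVP => j.
rewrite (_ : _ \o _ = rV_coord (lift ord0 j)); first exact: measurable_rV_coord.
by apply/funext => x; rewrite /rV_coord /= mxE.
Qed.

Section step.
Variables (n : nat) (mu : {sigma_finite_measure set 'rV[R]_n -> \bar R}).

Definition lebesgue_rV_step : set 'rV[R]_n.+1 -> \bar R :=
  pushforward (@lebesgue_measure R \x mu)%E (@rV_cons n).

Let step0 : lebesgue_rV_step set0 = 0%E.
Proof. by rewrite /lebesgue_rV_step /pushforward preimage_set0 measure0. Qed.

Let step_ge0 A : (0 <= lebesgue_rV_step A)%E.
Proof. by rewrite /lebesgue_rV_step /pushforward measure_ge0. Qed.

Let step_sigma_additive : semi_sigma_additive lebesgue_rV_step.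
Proof.
have /= := @measure_semi_sigma_additive _ _ _
  (measure_function_pushforward__canonical__measure_function_Measure
     (@lebesgue_measure R \x mu)%E (@measurable_rV_cons n)).
exact.
Qed.

HB.instance Definition _ := isMeasure.Build _ _ _
  lebesgue_rV_step step0 step_ge0 step_sigma_additive.

Let step_sigma_finite : sigma_finite setT lebesgue_rV_step.
Proof.
have [F FT Foo] : sigma_finite setT (@lebesgue_measure R \x mu)%E.
  exact: sigma_finite_product_measure.
exists (fun k => @rV_uncons n @^-1` F k).
  by rewrite -preimage_bigcup -FT preimage_setT.
move=> k; have [mF Fk] := Foo k; split.
  by rewrite -[X in measurable X]setTI; exact: measurable_rV_uncons.
rewrite /lebesgue_rV_step /pushforward -comp_preimage.
by rewrite (_ : _ \o _ = id) // funeqE; exact: rV_consK.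
Qed.

HB.instance Definition _ :=
  Measure_isSigmaFinite.Build _ _ _ lebesgue_rV_step step_sigma_finite.

End step.

Fixpoint lebesgue_rV n : {sigma_finite_measure set 'rV[R]_n -> \bar R} :=
  match n with
  | 0 => dirac (0 : 'rV[R]_0)
  | m.+1 => lebesgue_rV_step (lebesgue_rV m)
  end.

Lemma lebesgue_rV_box n (A : 'I_n -> set R) : (forall i, measurable (A i)) ->
  lebesgue_rV n [set x | forall i, A i (x ord0 i)] =
  (\prod_(i < n) lebesgue_measure (A i))%E.
Proof.
elim: n A => [A _|n IH A mA].
  rewrite big_ord0 /= diracE mem_set //=.
  by move=> [].
rewrite big_ord_recl -IH; last by [].
pose B : set 'rV[R]_n := [set y | forall j, A (lift ord0 j) (y ord0 j)].
have mB : measurable B.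
  rewrite (_ : B = \bigcap_(i in [set: 'I_n]) (rV_coord i @^-1` A (lift ord0 i))).
    apply: fin_bigcap_measurable => // i _.
    by rewrite -[X in measurable X]setTI; exact: measurable_rV_coord.
  by apply/seteqP; split => x /= h i; [move=> _|]; exact: h.
rewrite /= /lebesgue_rV_step /pushforward -/B -product_measure1E //; last exact: mA.
congr (_ _); apply/seteqP; split => [[a y] /= h|[a y] [/= ha hy] i].
  split; first by have := h ord0; rewrite rV_cons0.
  by move=> i; have := h (lift ord0 i); rewrite rV_consS.
by case: (unliftP ord0 i) => [j ->|->]; rewrite ?rV_consS ?rV_cons0.
Qed.

End lebesgue_rV.

Section euclidean.
Context {R : realType} {d : nat}.
Implicit Types (x y e : 'rV[R]_d) (A : set 'rV[R]_d) (f : 'rV[R]_d -> R).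

Definition dotp x y : R := \sum_(i < d) x ord0 i * y ord0 i.

(* The library norm on ['rV[R]_d] is the sup norm. *)
Definition enorm x : R := Num.sqrt (dotp x x).

Definition diameter A : R := sup [set enorm (x - y) | x in A & y in A].

Definition half_space e (lam : R) : set 'rV[R]_d := [set x | dotp x e > lam].

Definition reflection e (lam : R) x : 'rV[R]_d :=
  x - (2 * dotp x e) *: e + (2 * lam) *: e.

Definition antisymmetric_wrt e (lam : R) f := forall x, f x = - f (reflection e lam x).

Definition Cb f := continuous f /\ bounded_fun f.

Definition ebase (i : 'I_d) : 'rV[R]_d := delta_mx ord0 i.

(* Continuity of [f] itself follows from that of its first-order partials. *)
Definition C2_near f x :=
  \forall y \near x, forall i j : 'I_d,
    [/\ derivable f y (ebase i),
        {for y, continuous ('D_(ebase i) f)},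
        derivable ('D_(ebase i) f) y (ebase j) &
        {for y, continuous ('D_(ebase j) ('D_(ebase i) f))}].

(* The supremum is pointwise, not essential: the equation constrains a viscosity
   super-solution at every point, so that changing [c] on a null set matters. *)
Definition Linfty_norm A f : R := sup [set `|f x| | x in A].

Definition Lp_norm A (p : R) f : \bar R :=
  Lnorm (lebesgue_rV d) p%:E (fun x => (f x * \1_A x)%:E).

End euclidean.

Section operator.
Context {R : realType}.

Definition bernstein (Psi : R -> R) :=
  [/\ forall n x, 0 < x -> derivable (Psi^`(n))%classic x 1,
      forall x, 0 < x -> 0 <= Psi x &
      forall n x, (1 <= n)%N -> 0 < x -> (-1) ^+ n * (Psi^`(n))%classic x <= 0].

(* A Bernstein function also has a drift term in general; it vanishes under
   [weak_scaling] since [a2 < 1]. *)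
Definition bernstein_measure (Psi : R -> R)
    (m : {measure set (measurableTypeR R) -> \bar R}) :=
  m [set t : R | t <= 0] = 0%E /\
  forall lam : R, 0 < lam ->
    (Psi lam)%:E = (\int[m]_(t in `]0%R, +oo[) (1 - expR (- (lam * t)))%:E)%E.

Definition weak_scaling (Psi : R -> R) :=
  exists a1 a2 b1 : R, [/\ 0 < a1, a1 <= a2, a2 < 1, 1 <= b1 &
    forall r s : R, 1 <= r -> r <= s ->
      b1^-1 * (s / r) `^ a1 <= Psi s / Psi r <= b1 * (s / r) `^ a2].

Definition jump_kernel (d : nat) (m : {measure set (measurableTypeR R) -> \bar R})
    (r : R) : R :=
  \int[m]_(t in `]0, +oo[)
    ((4 * pi * t) `^ (- (d%:R / 2)) * expR (- (r ^+ 2 / (4 * t)))).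

Definition slow_decay (j : R -> R) :=
  exists b2 : R, 1 < b2 /\ forall r, 1 <= r -> j r <= b2 * j (r + 1).

(* This is Psi(-Delta) for [j := jump_kernel d m], [m] the measure of Psi. *)
Definition Psi_laplacian d (j : R -> R) (f : 'rV[R]_d -> R) (x : 'rV[R]_d) : R :=
  - (2^-1 * \int[lebesgue_rV d]_z
      ((f (x + z) + f (x - z) - 2 * f x) * j (enorm z))).

Definition viscosity_supersolution d (j : R -> R) (Omega : set 'rV[R]_d)
    (c u : 'rV[R]_d -> R) :=
  Cb u /\
  forall x phi, Omega x -> Cb phi -> C2_near phi x -> phi x = u x ->
    (forall y, y != x -> phi y < u y) ->
    0 <= Psi_laplacian j phi x + c x * u x.

End operator.

(* Main.v *)
Require Import Defs.
From HB Require Import structures.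
From mathcomp Require Import all_boot all_order all_algebra.
From mathcomp Require Import all_classical all_reals all_analysis.
From mathcomp Require Import measurable_realfun ring lra.

(** The estimate follows from testing the equation at one point only, the minimum
  [x] of [u] over the half-space.

  Suppose that [u] is negative somewhere in [Omega], and let [- M] be its minimum
  over the closed half-space. It is attained at some [x] in [Omega], because [u] is
  nonnegative on the rest of the half-space and vanishes on the hyperplane. A test
  function touching [u] from below at [x], and close to [u] away from [x], gives
  [\int (u (x + z) + M) j(|z|) dz <= c^\-(x) M] up to an arbitrarily small error.
  The integrand may be negative on the other side of the hyperplane, but the
  values at a point and at its mirror image sum to [2 M], and the one in the
  half-space carries the larger weight because [j] decreases and the point is
  closer to [x]. So if [E] denotes the set of points of [Omega] where
  [u < - M / 2], every point outside [E] counts for at least [M / 2] in this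
  symmetrized sense, and
  [\int_(x + z \notin E) j(|z|) dz <= 2 c^\-(x)] (nonlocal_minimum_principle).

  On the other hand a set of small volume [V] cannot contain most of the singular
  measure [j(|z|) dz]: the left-hand side is at least of order [V ^ (- 1 / p)],
  where [p] depends on the lower scaling exponent of [Psi] (nonlocal_tail). Indeed
  [j] is a mixture over the measure [m] of the heat kernels at time [t]; for
  [t >= s], with [s] of order [V ^ (2 / d)], a heat kernel has at least half of its
  mass outside any set of volume [V], so the integral is at least
  [m([s, +oo[) / 2], and the scaling assumption turns into a power lower bound on
  the tails of [m]. When [V] is not small one uses instead that [E - x] lies in a
  ball whose radius is the diameter of [Omega], outside of which the kernel has a
  positive mass.

  Together, [1 <= 2 K c^\-(x) V ^ (1 / p)] with [V] the volume of [E]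
  (negative_minimum_bound). As the norm of [u^\-] in [L^p] is at least
  [(M / 2) V ^ (1 / p)] by Chebyshev's inequality, this is the estimate. As [V] is
  at most the volume of [Omega], it also excludes a negative minimum when [Omega]
  is small.

  The symmetrization requires Lebesgue measure to be invariant under reflections in
  arbitrary hyperplanes, which is deduced from the uniqueness of
  translation-invariant measures (translation_invariant_unique). *)

Set Implicit Arguments.
Unset Strict Implicit.
Unset Printing Implicit Defensive.

Import Order.TTheory GRing.Theory Num.Theory.
Import numFieldNormedType.Exports.

Local Open Scope classical_set_scope.
Local Open Scope ring_scope.

(** * Borel sets of [R^n] *)

Section borel_rV.
Context {R : realType} {n : nat}.
Implicit Types x y : 'rV[R]_n.

Lemma coord_le_mx_norm x i : `|x ord0 i| <= `|x|.
Proof.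
by rewrite [leRHS]/Num.norm/= mx_normrE (le_bigmax _ (fun ij => `|x ij.1 ij.2|) (ord0, i)).
Qed.

Lemma mx_norm_ltP x (r : R) : 0 < r ->
  (`|x| < r) <-> forall i, `|x ord0 i| < r.
Proof.
move=> r0; split=> [xr i|xr].
  by apply: le_lt_trans xr; exact: coord_le_mx_norm.
rewrite [ltLHS]/Num.norm/= mx_normrE; apply/bigmax_ltP; split => //.
by case=> i j _ /=; rewrite (ord1 i).
Qed.

Lemma measurable_box (A : 'I_n -> set R) : (forall i, measurable (A i)) ->
  measurable [set x : 'rV[R]_n | forall i, A i (x ord0 i)].
Proof.
move=> mA; rewrite (_ : mkset _ =
    \bigcap_(i in [set: 'I_n]) (@rV_coord R n i @^-1` A i)).
  apply: fin_bigcap_measurable => // i _.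
  by rewrite -[X in measurable X]setTI; exact: measurable_rV_coord.
by apply/seteqP; split => x /= h i; [move=> _|]; exact: h.
Qed.

(** An open set is the union of the rational cubes that it contains. *)
Lemma open_measurable_rV (A : set 'rV[R]_n) : open A -> measurable A.
Proof.
move=> oA.
pose Q (p : 'rV[rat]_n * nat) : set 'rV[R]_n :=
  [set x | forall i, x ord0 i \in
     `](ratr (p.1 ord0 i) - p.2.+1%:R^-1), (ratr (p.1 ord0 i) + p.2.+1%:R^-1)[].
have mQ p : measurable (Q p).
  apply: (@measurable_box (fun i => [set` `](ratr (p.1 ord0 i) - p.2.+1%:R^-1),
     (ratr (p.1 ord0 i) + p.2.+1%:R^-1)[])) => i.
  exact: measurable_itv.
rewrite (_ : A = \bigcup_(p in [set p | Q p `<=` A]) Q p).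
  rewrite bigcup_mkcond; apply: countable_bigcupT_measurable => [|p].
    exact: countableP.
  by case: ifP.
apply/seteqP; split => [x Ax|x [p /= QA /QA]//].
have /nbhs_ballP[e /= e0 eA] : nbhs x A by exact: open_nbhs_nbhs.
have [k ke] : exists k : nat, k.+1%:R^-1 < e / 2.
  have /ltr_add_invr[k] : 0 < e / 2 by rewrite divr_gt0.
  by rewrite add0r; exists k.
have /choice[q Hq] i : exists q : rat, ratr q \in
    `](x ord0 i - k.+1%:R^-1), (x ord0 i + k.+1%:R^-1)[.
  by apply: rat_in_itvoo; rewrite ltrD2l gtrN.
exists (\row_i q i, k) => /= [y yQ|i].
  apply: eA; rewrite -ball_normE /ball_/=; apply/(mx_norm_ltP _ e0) => i.
  have := yQ i; have := Hq i; rewrite !mxE/= !in_itv/= => /andP[h1 h2] /andP[h3 h4].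
  move: ke h1 h2 h3 h4; set r := k.+1%:R^-1 => ke h1 h2 h3 h4.
  by rewrite ltr_norml; apply/andP; split; lra.
by have := Hq i; rewrite /= mxE !in_itv/= ltrBlDr => /andP[-> h2]; rewrite ltrBlDr h2.
Qed.

Lemma continuous_measurable_rV (f : 'rV[R]_n -> R) :
  continuous f -> measurable_fun setT f.
Proof.
move=> /continuousP cf; apply: (measurability _ (RGenOpens.measurableE R)).
move=> _ [_ [a [b ->] <-]]; rewrite setTI; apply: open_measurable_rV.
by apply: cf; exact: interval_open.
Qed.

Lemma measurable_rV_add d (T : measurableType d) (f g : T -> 'rV[R]_n) :
  measurable_fun setT f -> measurable_fun setT g ->
  measurable_fun setT (fun t => f t + g t).
Proof.
move=> /measurable_fun_rVP mf /measurable_fun_rVP mg; apply/measurable_fun_rVP => i.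
rewrite (_ : _ \o _ = (rV_coord i \o f) \+ (rV_coord i \o g)).
  exact: measurable_funD.
by apply/funext => t /=; rewrite /rV_coord mxE.
Qed.

Lemma measurable_rV_opp d (T : measurableType d) (f : T -> 'rV[R]_n) :
  measurable_fun setT f -> measurable_fun setT (fun t => - f t).
Proof.
move=> /measurable_fun_rVP mf; apply/measurable_fun_rVP => i.
rewrite (_ : _ \o _ = \- (rV_coord i \o f)).
  exact: measurableT_comp.
by apply/funext => t /=; rewrite /rV_coord mxE.
Qed.

End borel_rV.

(** * Uniqueness of translation-invariant measures *)

Lemma eq_measure_on_integral d (T : measurableType d) (R : realType)
    (m1 m2 : {measure set T -> \bar R}) (f : T -> \bar R) :
  (forall A, measurable A -> m1 A = m2 A) ->
  (\int[m1]_x f x = \int[m2]_x f x)%E.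
Proof. by move=> h; apply: eq_measure_integral => A mA _; exact: h. Qed.

Lemma lebesgue_measure_shift (R : realType) (a : R) (A : set R) : measurable A ->
  lebesgue_measure [set x | A (x + a)] = lebesgue_measure A.
Proof.
move=> mA; apply/esym.
have mf : measurable_fun setT (fun x : measurableTypeR R => x + a : measurableTypeR R).
  exact: measurable_funD.
apply: (@lebesgue_measure_unique R (measure_function_pushforward__canonical__measure_function_Measure
     (@lebesgue_measure R) mf)) => // X [[u v] /= uv <-].
rewrite /pushforward (_ : _ @^-1` _ = `]u - a, v - a]%classic).
  by rewrite !lebesgue_measure_itv/= !lte_fin ltrD2r -!EFinB; congr (if _ then _%:E else _); ring.
by apply/seteqP; split => x /=; rewrite !in_itv/=; lra.
Qed.

Section translation.
Context {R : realType}.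
Local Notation mu := (lebesgue_rV (R := R)).

Definition translation_invariant n (nu : set 'rV[R]_n -> \bar R) :=
  forall (h : 'rV[R]_n) (A : set 'rV[R]_n), measurable A -> nu [set x | A (x + h)] = nu A.

Lemma measurable_shift_rV n (h : 'rV[R]_n) :
  measurable_fun setT (fun x : 'rV[R]_n => x + h).
Proof. exact: measurable_rV_add. Qed.

Lemma measurable_preimage_shift n (h : 'rV[R]_n) (A : set 'rV[R]_n) :
  measurable A -> measurable [set x | A (x + h)].
Proof.
move=> mA; rewrite -[X in measurable X]setTI.
exact: (measurable_shift_rV h).
Qed.

(** By Fubini, from the one-dimensional case. *)
Lemma lebesgue_rV_translation n : translation_invariant (mu n).
Proof.
elim: n => [|n IH] h A mA.
  congr (lebesgue_rV 0 _); apply/funext => x /=; congr A.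
  by apply/rowP => -[].
pose h' : 'rV[R]_n := \row_j h ord0 (lift ord0 j).
have hE p : @rV_cons R n p + h = rV_cons (p.1 + h ord0 ord0, p.2 + h').
  apply/rowP => i; rewrite mxE; case: (unliftP ord0 i) => [j ->|->].
    by rewrite !rV_consS !mxE.
  by rewrite !rV_cons0.
pose B := @rV_cons R n @^-1` A.
have mB : measurable B.
  by rewrite -[X in measurable X]setTI; exact: measurable_rV_cons.
rewrite /= /lebesgue_rV_step /pushforward /product_measure1 -/B.
have secE x : mu n (xsection B (x + h ord0 ord0)) =
    mu n (xsection (@rV_cons R n @^-1` [set x | A (x + h)]) x).
  rewrite -(IH h'); last exact: measurable_xsection.
  congr (mu n _); apply/seteqP; split => y; rewrite /xsection/= !inE /B/= hE//.
transitivity (\int[@lebesgue_measure R]_x mu n (xsection B ((x : R) + h ord0 ord0)%R))%E.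
  by apply: eq_integral => x _; rewrite secE.
have mf : measurable_fun setT
    (fun x : measurableTypeR R => x + h ord0 ord0 : measurableTypeR R).
  exact: measurable_funD.
have := @ge0_integral_pushforward _ _ (measurableTypeR R) (measurableTypeR R) R _ mf
  lebesgue_measure setT (fun x => mu n (xsection B x)) measurableT.
rewrite preimage_setT /comp => <-; last 2 first.
  exact: measurable_fun_xsection.
  by move=> x _; exact: measure_ge0.
apply: (eq_measure_on_integral (m1 := measure_function_pushforward__canonical__measure_function_Measure
     (@lebesgue_measure R) mf)) => C mC.
exact: lebesgue_measure_shift.
Qed.

Lemma integral_translation n (nu : {measure set 'rV[R]_n -> \bar R}) h
    (f : 'rV[R]_n -> \bar R) :
  translation_invariant nu -> measurable_fun setT f -> (forall x, 0 <= f x)%E ->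
  (\int[nu]_x f (x + h)%R = \int[nu]_x f x)%E.
Proof.
move=> nuT mf f0.
have := @ge0_integral_pushforward _ _ _ _ R _ (measurable_shift_rV h)
  nu setT f measurableT mf (fun x _ => f0 x).
rewrite preimage_setT /comp => <-.
apply: (eq_measure_on_integral (m1 := measure_function_pushforward__canonical__measure_function_Measure
     nu (measurable_shift_rV h))) => C mC.
exact: nuT.
Qed.

(** Two translation-invariant measures are proportional. In the double integral
  of [1_A(x) 1_B(x + y)] under [nu(dx) mu(dy)], shifting [y] by [-x] gives the
  left-hand side, and shifting [x] by [-y] gives the right-hand side; no
  approximation of [A] or [B] by cubes is needed. *)
Lemma translation_invariant_unique n (nu : {sigma_finite_measure set 'rV[R]_n -> \bar R})
    (A B : set 'rV[R]_n) :
  translation_invariant nu -> measurable A -> measurable B ->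
  (nu A * mu n B = nu B * mu n [set x | A (- x)%R])%E.
Proof.
move=> nuT mA mB.
pose iA x : \bar R := (\1_A x)%:E; pose iB x : \bar R := (\1_B x)%:E.
have miA : measurable_fun setT iA by apply/measurable_EFinP; exact: measurable_indic.
have miB : measurable_fun setT iB by apply/measurable_EFinP; exact: measurable_indic.
have iA0 x : (0 <= iA x)%E by rewrite lee_fin.
have iB0 x : (0 <= iB x)%E by rewrite lee_fin.
have mS : measurable_fun setT (fun p : 'rV[R]_n * 'rV[R]_n => p.1 + p.2).
  exact: measurable_rV_add.
have mD : measurable_fun setT (fun p : 'rV[R]_n * 'rV[R]_n => p.1 - p.2).
  by apply: measurable_rV_add => //; exact: measurable_rV_opp.
have mN : measurable_fun setT (fun x : 'rV[R]_n => - x) by exact: measurable_rV_opp.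
have mA' : measurable [set x | A (- x)%R].
  by rewrite -[X in measurable X]setTI; exact: mN.
transitivity (\int[nu]_x \int[mu n]_y (iA x * iB (x + y)%R))%E.
  rewrite -[in LHS](setIT A) -integral_indic//.
  rewrite -ge0_integralZr//.
  apply: eq_integral => x _.
  rewrite ge0_integralZl//; last first.
    apply: (measurableT_comp miB); exact: measurable_rV_add.
  congr (_ * _)%E.
  under eq_integral do rewrite addrC.
  rewrite (@integral_translation _ _ _ iB)//; last exact: lebesgue_rV_translation.
  by rewrite integral_indic// setIT.
transitivity (\int[mu n]_y \int[nu]_x (iA x * iB (x + y)%R))%E.
  apply: (fubini_tonelli (m1 := nu) (m2 := mu n) (fun p => iA p.1 * iB (p.1 + p.2)%R))%E.
    apply: emeasurable_funM; first exact: measurableT_comp.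
    exact: (measurableT_comp miB).
  by move=> p; rewrite mule_ge0.
transitivity (\int[mu n]_y \int[nu]_x (iA (x - y)%R * iB x))%E.
  apply: eq_integral => y _.
  rewrite -(@integral_translation _ nu y (fun x => iA (x - y)%R * iB x))%E//.
  - by apply: eq_integral => x _; rewrite addrK.
  - apply: emeasurable_funM => //; apply: (measurableT_comp miA).
    exact: measurable_rV_add.
  - by move=> x; rewrite mule_ge0.
transitivity (\int[nu]_x \int[mu n]_y (iA (x - y)%R * iB x))%E.
  apply/esym/(fubini_tonelli (m1 := nu) (m2 := mu n) (fun p => iA (p.1 - p.2)%R * iB p.1))%E.
    apply: emeasurable_funM; last exact: measurableT_comp.
    exact: (measurableT_comp miA).
  by move=> p; rewrite mule_ge0.
rewrite -[in RHS](setIT B) -integral_indic//.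
rewrite -ge0_integralZr//.
apply: eq_integral => x _.
rewrite ge0_integralZr//; last first.
  apply: (measurableT_comp miA); apply: measurable_rV_add => //.
rewrite muleC; congr (_ * _)%E.
rewrite -[in RHS](setIT [set x | A (- x)%R]) -integral_indic//.
rewrite -(@integral_translation _ (mu n) (- x) (fun y => (\1_[set x | A (- x)%R] y)%:E))%E.
- apply: eq_integral => y _; rewrite /iA !indicE; congr (_%:R%:E).
  by congr nat_of_bool; apply/idP/idP; rewrite !inE/= opprB.
- exact: lebesgue_rV_translation.
- by apply/measurable_EFinP; exact: measurable_indic.
- by move=> y; rewrite lee_fin.
Qed.

End translation.

(** * Euclidean isometries preserve Lebesgue measure *)

Lemma cvg_sumr (R : realType) (I T : Type) (r : seq I) (F : set_system T)
    {FF : Filter F} (f : I -> T -> R) (a : I -> R) :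
  (forall i, f i x @[x --> F] --> a i) ->
  \sum_(i <- r) f i x @[x --> F] --> \sum_(i <- r) a i.
Proof. by move=> h; apply: cvg_big => //; exact: add_continuous. Qed.

Section enorm_lemmas.
Context {R : realType} {n : nat}.
Implicit Types x y : 'rV[R]_n.

Lemma dotpC x y : dotp x y = dotp y x.
Proof. by rewrite /dotp; apply: eq_bigr => i _; rewrite mulrC. Qed.

Lemma dotpDl x y z : dotp (x + y) z = dotp x z + dotp y z.
Proof.
by rewrite /dotp -big_split; apply: eq_bigr => i _; rewrite mxE mulrDl.
Qed.

Lemma dotpZl a x z : dotp (a *: x) z = a * dotp x z.
Proof.
by rewrite /dotp mulr_sumr; apply: eq_bigr => i _; rewrite mxE mulrA.
Qed.

Lemma dotpNl x z : dotp (- x) z = - dotp x z.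
Proof. by rewrite -scaleN1r dotpZl mulN1r. Qed.

Lemma dotpBl x y z : dotp (x - y) z = dotp x z - dotp y z.
Proof. by rewrite dotpDl dotpNl. Qed.

Lemma dotpDr x y z : dotp z (x + y) = dotp z x + dotp z y.
Proof. by rewrite dotpC dotpDl !(dotpC z). Qed.

Lemma dotpZr a x z : dotp z (a *: x) = a * dotp z x.
Proof. by rewrite dotpC dotpZl dotpC. Qed.

Lemma dotpBr x y z : dotp z (x - y) = dotp z x - dotp z y.
Proof. by rewrite dotpC dotpBl !(dotpC z). Qed.

Lemma dotp_ge0 x : 0 <= dotp x x.
Proof. by apply: sumr_ge0 => i _; rewrite -expr2 sqr_ge0. Qed.

Lemma sqr_enorm x : enorm x ^+ 2 = dotp x x.
Proof. by rewrite sqr_sqrtr// dotp_ge0. Qed.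

Lemma enorm_ge0 x : 0 <= enorm x.
Proof. exact: sqrtr_ge0. Qed.

Lemma sqr_coord_le_dotp x i : x ord0 i ^+ 2 <= dotp x x.
Proof.
rewrite /dotp (bigD1 i)//= -expr2 lerDl.
by apply: sumr_ge0 => j _; rewrite -expr2 sqr_ge0.
Qed.

Lemma coord_le_enorm x i : `|x ord0 i| <= enorm x.
Proof. by rewrite -sqrtr_sqr ler_wsqrtr// sqr_coord_le_dotp. Qed.

Lemma dotp_gt0 x : x != 0 -> 0 < dotp x x.
Proof.
move=> /rV0Pn[i xi]; apply: lt_le_trans (sqr_coord_le_dotp x i).
by rewrite exprn_even_gt0.
Qed.

Lemma enorm_gt0 x : x != 0 -> 0 < enorm x.
Proof. by move=> x0; rewrite sqrtr_gt0 dotp_gt0. Qed.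

Lemma enormN x : enorm (- x) = enorm x.
Proof. by rewrite /enorm dotpNl dotpC dotpNl opprK. Qed.

Lemma cvg_dotp (T : Type) (F : set_system T) {FF : Filter F} (f g : T -> 'rV[R]_n) x y :
  (forall i, f t ord0 i @[t --> F] --> x ord0 i) ->
  (forall i, g t ord0 i @[t --> F] --> y ord0 i) ->
  dotp (f t) (g t) @[t --> F] --> dotp x y.
Proof. by move=> fx gy; apply: cvg_sumr => i; exact: cvgM. Qed.

Lemma cvg_coordB (T : Type) (F : set_system T) {FF : Filter F} (f : T -> 'rV[R]_n) x y i :
  f t ord0 i @[t --> F] --> x ord0 i ->
  (f t - y) ord0 i @[t --> F] --> (x - y) ord0 i.
Proof.
move=> fx; rewrite [X in X @ _ --> _](_ : _ = (fun t => f t ord0 i - y ord0 i)).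
  by rewrite !mxE; apply: cvgB => //; exact: cvg_cst.
by apply/funext => z; rewrite !mxE.
Qed.

Lemma continuous_dotp (y : 'rV[R]_n) : continuous (fun x => dotp (x - y) (x - y)).
Proof.
move=> x; apply: (@cvg_dotp _ _ (nbhs_filter x)) => i;
  apply: (@cvg_coordB _ _ (nbhs_filter x) id);
  exact: (@coord_continuous R _ _ ord0 i x).
Qed.

Lemma continuous_dotpl (e : 'rV[R]_n) : continuous (fun x => dotp x e).
Proof.
move=> x; apply: (@cvg_dotp _ _ (nbhs_filter x) id) => i; last exact: cvg_cst.
exact: (@coord_continuous R _ _ ord0 i x).
Qed.

Lemma measurable_enorm : measurable_fun setT (@enorm R n).
Proof.
apply: continuous_measurable_rV => x.
apply: continuous_comp; last exact: sqrt_continuous.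
rewrite (_ : (fun x => _) = (fun x => dotp (x - 0) (x - 0))).
  exact: continuous_dotp.
by apply/funext => z; rewrite subr0.
Qed.

End enorm_lemmas.

Section isometry.
Context {R : realType} {n : nat}.
Local Notation mu := (lebesgue_rV (R := R) n).
Implicit Types L phi : 'rV[R]_n -> 'rV[R]_n.

Let B : set 'rV[R]_n := [set x | enorm x < 1].

Let mB : measurable B.
Proof.
rewrite (_ : B = enorm @^-1` `]-oo, 1[%classic).
  by rewrite -[X in measurable X]setTI; exact: measurable_enorm.
by apply/seteqP; split => x /=; rewrite in_itv.
Qed.

Let muB_fin : (mu B < +oo)%E.
Proof.
apply: (@le_lt_trans _ _ (mu [set x | forall i, `]-1, 1[%classic (x ord0 i)])).
  apply: le_measure; rewrite ?inE//; first exact: (@measurable_box _ _ (fun=> `]-1, 1[%classic)).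
  move=> x /= Bx i; rewrite in_itv/= -ltr_norml.
  exact: le_lt_trans (coord_le_enorm _ _) Bx.
rewrite (@lebesgue_rV_box _ _ (fun=> `]-1, 1[%classic))//.
rewrite -ge0_fin_numE ?prode_ge0// prode_fin_num//; last first.
  by move=> i _; rewrite lebesgue_measure_itv/=; case: ifP.
Qed.

Let muB_gt0 : (0 < mu B)%E.
Proof.
pose c : R := n.+1%:R^-1.
have c0 : 0 < c by rewrite invr_gt0.
apply: (@lt_le_trans _ _ (mu [set x | forall i, `]-c, c[%classic (x ord0 i)])).
  rewrite (@lebesgue_rV_box _ _ (fun=> `]-c, c[%classic))//.
  rewrite (eq_bigr (fun=> (c + c)%:E)); last first.
    move=> i _; rewrite lebesgue_measure_itv/= lte_fin ifT ?opprK//.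
    by rewrite gtrN.
  by rewrite prodEFin lte_fin; apply: prodr_gt0 => i _; rewrite addr_gt0.
apply: le_measure; rewrite ?inE//; first exact: (@measurable_box _ _ (fun=> `]-c, c[%classic)).
move=> x /= xc; rewrite /B/= /enorm -sqrtr1 ltr_sqrt//.
apply: (@le_lt_trans _ _ (\sum_(i < n) c)).
  apply: ler_sum => i _; have := xc i; rewrite in_itv/= -ltr_norml => xic.
  rewrite -expr2 -real_normK ?num_real//.
  apply: (@le_trans _ _ (c * 1)); last by rewrite mulr1.
  rewrite expr2 ler_pM// ?ltW//; apply: lt_le_trans xic _.
  by rewrite invf_le1// ler1n.
rewrite sumr_const card_ord -mulr_natl /c.
by rewrite ltr_pdivrMr// mul1r ltr_nat.
Qed.

Let muB_inj (a b : \bar R) : (mu B * a = mu B * b)%E -> a = b.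
Proof.
have fB : mu B \is a fin_num by rewrite ge0_fin_numE.
by move=> ab; apply/le_anti; rewrite -(lee_pmul2l fB muB_gt0 a b)
  -(lee_pmul2l fB muB_gt0 b a) ab lexx.
Qed.

Let lebesgue_rV_opp (A : set 'rV[R]_n) : measurable A ->
  mu [set x | A (- x)] = mu A.
Proof.
move=> mA.
have := translation_invariant_unique (@lebesgue_rV_translation R n) mA mB.
by rewrite muleC => /muB_inj.
Qed.

Definition measure_preserving phi := measurable_fun setT phi /\
  forall A : set 'rV[R]_n, measurable A -> mu [set x | A (phi x)] = mu A.

(** The image of Lebesgue measure under [L] is translation-invariant, hence
  proportional to it; [L] preserves the unit ball, whose measure is positive and
  finite, so the factor is [1]. Asking [L] to be an involution covers the
  reflections and saves the discussion of the inverse. *)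
Lemma measure_preserving_isometry L : measurable_fun setT L ->
  {morph L : x y / x + y} -> involutive L -> (forall x, enorm (L x) = enorm x) ->
  measure_preserving L.
Proof.
move=> mL LD LK Le; split => // A mA.
pose nu := measure_function_pushforward__canonical__measure_function_Measure mu mL.
have nuS : sigma_finite setT nu.
  have [F FT Foo] := sigma_finiteT mu.
  exists (fun k => L @^-1` F k); first by rewrite -preimage_bigcup -FT preimage_setT.
  move=> k; have [mF Fk] := Foo k; split.
    by rewrite -[X in measurable X]setTI; exact: (mL _ _ mF).
  rewrite /nu/= /pushforward -comp_preimage (_ : L \o L = id)//.
  by apply/funext => x; exact: LK.
pose nus : {sigma_finite_measure set 'rV[R]_n -> \bar R} :=
  HB.pack_for (SigmaFiniteMeasure.type 'rV[R]_n R) (Measure.sort nu)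
    (Measure_isSigmaFinite.Build _ _ _ nu nuS).
have nuT : translation_invariant nus.
  move=> h C mC; rewrite /nus/= /pushforward.
  rewrite (_ : _ @^-1` _ = [set x | (L @^-1` C) (x + L h)]).
    apply: lebesgue_rV_translation.
    by rewrite -[X in measurable X]setTI; exact: (mL _ _ mC).
  by apply/seteqP; split => x /=; rewrite LD LK.
have := translation_invariant_unique nuT mA mB.
rewrite /nus/= /pushforward lebesgue_rV_opp//.
have -> : L @^-1` B = B by apply/seteqP; split => x /=; rewrite /B/= Le.
by rewrite muleC => /muB_inj.
Qed.

Lemma measure_preserving_opp : measure_preserving (fun x => - x).
Proof.
apply: measure_preserving_isometry.
- exact: measurable_rV_opp.
- by move=> x y; rewrite opprD.
- exact: opprK.
- exact: enormN.
Qed.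

Lemma measure_preserving_shift h : measure_preserving (fun x => x + h).
Proof.
by split; [exact: measurable_shift_rV|move=> A mA; exact: lebesgue_rV_translation].
Qed.

Lemma measure_preserving_comp phi psi :
  measure_preserving phi -> measure_preserving psi ->
  measure_preserving (phi \o psi).
Proof.
move=> [mphi phiP] [mpsi psiP]; split; first exact: measurableT_comp.
move=> A mA; rewrite -[RHS]phiP// -(psiP [set x | A (phi x)])//.
by rewrite -[X in measurable X]setTI; exact: mphi.
Qed.

Lemma ge0_integral_preserving phi (f : 'rV[R]_n -> \bar R) :
  measure_preserving phi -> measurable_fun setT f -> (forall x, 0 <= f x)%E ->
  (\int[mu]_x f (phi x) = \int[mu]_x f x)%E.
Proof.
move=> [mphi phiP] mf f0.
have := @ge0_integral_pushforward _ _ _ _ R _ mphi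
  mu setT f measurableT mf (fun x _ => f0 x).
rewrite preimage_setT /comp => <-.
apply: (eq_measure_on_integral (m1 :=
  measure_function_pushforward__canonical__measure_function_Measure mu mphi)) => C mC.
exact: phiP.
Qed.

Lemma integrable_preserving phi (f : 'rV[R]_n -> R) : measure_preserving phi ->
  mu.-integrable setT (EFin \o f) ->
  mu.-integrable setT (EFin \o (f \o phi)).
Proof.
move=> pphi /integrableP[mf foo]; have [mphi phiP] := pphi.
have mfphi : measurable_fun setT (EFin \o (f \o phi)).
  exact: (measurableT_comp mf mphi).
apply/integrableP; split => //.
rewrite (@ge0_integral_preserving phi (fun x => `|(f x)%:E|)%E)//.
exact: measurableT_comp.
Qed.

Lemma Rintegral_preserving phi (f : 'rV[R]_n -> R) : measure_preserving phi ->
  mu.-integrable setT (EFin \o f) ->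
  \int[mu]_x f (phi x) = \int[mu]_x f x.
Proof.
move=> pphi intf; have [mphi phiP] := pphi.
have intfphi := integrable_preserving pphi intf.
have /integrableP[mf _] := intf.
have := @integral_pushforward _ _ _ _ R _ mphi mu setT (EFin \o f) mf
  intfphi measurableT.
rewrite preimage_setT /Rintegral /comp => <-; congr fine.
apply: (eq_measure_on_integral (m1 :=
  measure_function_pushforward__canonical__measure_function_Measure mu mphi)) => C mC.
exact: phiP.
Qed.

(** This is how antisymmetry is used: a possibly signed and unbalanced integrand
  is controlled through its sum with its mirror image. *)
Lemma Rintegral_ge0_symmetrization phi (f : 'rV[R]_n -> R) :
  measure_preserving phi -> mu.-integrable setT (EFin \o f) ->
  (forall x, 0 <= f x + f (phi x)) -> 0 <= \int[mu]_x f x.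
Proof.
move=> pphi intf f0; have intfphi := integrable_preserving pphi intf.
have : 0 <= \int[mu]_x (f x + f (phi x)) by apply: Rintegral_ge0.
by rewrite RintegralD// (Rintegral_preserving pphi)// -mulr2n pmulrn_lge0.
Qed.

End isometry.

(** * Heat kernels *)

Section heat_kernel.
Context {R : realType}.

(** The Gauss-Weierstrass kernel of [R^n], as a function of the radius [r] and of
  the time [t]; averaging it over [t] yields the jump kernel. *)
Definition heat (n : nat) (r t : R) : R :=
  (4 * pi * t) `^ (- (n%:R / 2)) * expR (- (r ^+ 2 / (4 * t))).

Lemma heat_ge0 n r t : 0 <= heat n r t.
Proof. by rewrite mulr_ge0 ?powR_ge0 ?expR_ge0. Qed.

Lemma heat_gt0 n r t : 0 < t -> 0 < heat n r t.
Proof.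
by move=> t0; rewrite mulr_gt0 ?expR_gt0// powR_gt0// !mulr_gt0// pi_gt0.
Qed.

Lemma heat_le_peak n r t : 0 < t -> heat n r t <= (4 * pi * t) `^ (- (n%:R / 2)).
Proof.
move=> t0; rewrite ler_piMr ?powR_ge0// -expR0 ler_expR oppr_le0.
by rewrite divr_ge0 ?sqr_ge0// mulr_ge0// ltW.
Qed.

Lemma heat_anti n r s t : 0 < t -> 0 <= r <= s -> heat n s t <= heat n r t.
Proof.
move=> t0 /andP[r0 rs]; rewrite ler_wpM2l ?powR_ge0// ler_expR lerN2.
by rewrite ler_wpM2r ?invr_ge0 ?mulr_ge0 ?(ltW t0)// lerXn2r// nnegrE (le_trans r0).
Qed.

Lemma measurable_heat2 n :
  measurable_fun [set: measurableTypeR R * 'rV[R]_n]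
    (fun p : measurableTypeR R * 'rV[R]_n =>
       heat n (enorm p.2) p.1 * \1_`]0, +oo[%classic (p.1 : R)).
Proof.
have mt : measurable_fun [set: measurableTypeR R * 'rV[R]_n]
    (fun p : measurableTypeR R * 'rV[R]_n => (p.1 : R)).
  exact: measurable_fst.
rewrite (_ : (fun p => _) = (fun p : measurableTypeR R * 'rV[R]_n =>
   ((4 * pi * (p.1:R)) `^ (- (n%:R / 2)) *
     expR (- (enorm p.2 ^+ 2 * (4 * (p.1:R)) `^ (-1)))) *
   \1_`]0, +oo[%classic (p.1:R))).
  apply: measurable_funM.
    apply: measurable_funM.
      apply: (@measurableT_comp _ _ _ _ _ _ (@powR R ^~ _)) => //.
      by apply: measurable_funM => //.
    apply: measurableT_comp => //; apply: measurableT_comp => //.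
    apply: measurable_funM.
      by apply: measurable_funX; exact: (measurableT_comp measurable_enorm).
    apply: (@measurableT_comp _ _ _ _ _ _ (@powR R ^~ _)) => //.
    by apply: measurable_funM => //.
  by apply: measurableT_comp => //.
apply/funext => -[t z] /=; rewrite /heat indicE; case: (boolP (t \in _)); last by rewrite !mulr0.
rewrite inE/= in_itv/= andbT => t0.
by rewrite powR_inv1// mulr_ge0// ltW.
Qed.

Lemma measurable_heat n t : measurable_fun [set: 'rV[R]_n] (fun z => heat n (enorm z) t).
Proof.
apply: measurable_funM => //; apply: measurableT_comp => //.
apply: measurableT_comp => //; apply: measurable_funM => //.
by apply: measurable_funX; exact: measurable_enorm.
Qed.

Lemma dotp_rV_cons n (p : R * 'rV[R]_n) :
  dotp (rV_cons p) (rV_cons p) = p.1 ^+ 2 + dotp p.2 p.2.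
Proof.
rewrite /dotp big_ord_recl rV_cons0 -expr2; congr (_ + _).
by apply: eq_bigr => i _; rewrite rV_consS.
Qed.

(** The kernel is a product of one-dimensional normal densities of variance [2 t]. *)
Lemma heat_rV_cons n (p : R * 'rV[R]_n) t : 0 < t ->
  heat n.+1 (enorm (rV_cons p)) t =
  normal_pdf 0 (Num.sqrt (2 * t)) p.1 * heat n (enorm p.2) t.
Proof.
move=> t0; have s0 : Num.sqrt (2 * t) != 0.
  by rewrite gt_eqF// sqrtr_gt0 mulr_gt0.
have pt0 : 0 < 4 * pi * t by rewrite !mulr_gt0// pi_gt0.
rewrite normal_pdfE// /normal_peak /normal_fun /heat !sqr_enorm dotp_rV_cons.
rewrite sqr_sqrtr ?mulr_ge0 ?ltW//.
rewrite -powR12_sqrt; last by rewrite -mulr_natr !mulr_ge0 ?pi_ge0 ?ltW.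
rewrite -powRN (_ : 2 * t * pi *+ 2 = 4 * pi * t); last by rewrite -mulr_natr; ring.
rewrite mulrACA -powRD; last by rewrite (gt_eqF pt0) implybT.
rewrite -expRD; congr (_ `^ _ * expR _); first by rewrite -addn1 natrD; field.
rewrite subr0 (_ : 2 * t *+ 2 = 4 * t); last by rewrite -mulr_natr; ring.
by field; rewrite (gt_eqF t0).
Qed.

Lemma integral_heat n (t : R) : 0 < t ->
  (\int[lebesgue_rV n]_z (heat n (enorm z) t)%:E = 1)%E.
Proof.
move=> t0; elim: n => [|n IH].
  rewrite integral_dirac//; last first.
    by apply/measurable_EFinP; exact: measurable_heat.
  rewrite diracT mul1e /heat sqr_enorm /dotp big_ord0 !mul0r oppr0 powRr0 expR0.
  by rewrite mulr1.
rewrite [lebesgue_rV _]/=/lebesgue_rV_step ge0_integral_pushforward//; last 3 first.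
- exact: measurable_rV_cons.
- by apply/measurable_EFinP; exact: measurable_heat.
- by move=> z _; rewrite lee_fin heat_ge0.
rewrite preimage_setT fubini_tonelli1/=; last 2 first.
- apply/measurable_EFinP.
  exact: (measurableT_comp (@measurable_heat n.+1 t) (@measurable_rV_cons R n)).
- by move=> z; rewrite lee_fin heat_ge0.
rewrite -[RHS](integral_normal_pdf 0 (Num.sqrt (2 * t))).
apply: eq_integral => x _; rewrite /fubini_F/=.
under eq_integral do rewrite heat_rV_cons// EFinM/=.
rewrite ge0_integralZl//; last 3 first.
- by apply/measurable_EFinP; exact: measurable_heat.
- by move=> z _; rewrite lee_fin heat_ge0.
- by rewrite lee_fin normal_pdf_ge0.
by rewrite IH mule1.
Qed.

End heat_kernel.

(** * The jump kernel as a mixture of heat kernels *)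

Section one_sub_expR.
Context {R : realType}.

Lemma measurable_one_sub_expR (l : R) :
  measurable_fun (setT : set (measurableTypeR R)) (fun t : R => 1 - expR (- (l * t))).
Proof.
apply: measurable_funB => //; apply: measurableT_comp => //.
by apply: measurableT_comp => //; exact: measurable_funM.
Qed.

Lemma one_sub_expR_ge0 (l t : R) : 0 < l -> `]0, +oo[%classic t ->
  0 <= 1 - expR (- (l * t)).
Proof.
move=> l0 /=; rewrite in_itv/= andbT => t0.
by rewrite subr_ge0 -expR0 ler_expR oppr_le0 mulr_ge0// ltW.
Qed.

Lemma one_sub_expR_ge (t : R) : 0 <= t -> t / (1 + t) <= 1 - expR (- t).
Proof.
move=> t0; rewrite lerBrDr -lerBrDl.
rewrite (_ : 1 - t / (1 + t) = (1 + t)^-1); last by field; lra.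
by rewrite expRN lef_pV2 ?posrE ?expR_gt0 ?expR_ge1Dx//; lra.
Qed.

End one_sub_expR.

Section jump_kernel_integrals.
Context {R : realType} (Psi : R -> R) (m : {measure set (measurableTypeR R) -> \bar R}).
Hypothesis mPsi : bernstein_measure Psi m.
Local Notation pos := (`]0, +oo[%classic : set R).

Let mpos : measurable (pos : set (measurableTypeR R)).
Proof. exact: measurable_itv. Qed.

Let measurable_1exp (l : R) := measurable_one_sub_expR l.

(** On [[s, +oo[] the integrand [1 - exp (- t)] of [Psi 1] is bounded below. *)
Lemma bernstein_tail_lty (s : R) : 0 < s -> (m `[s, +oo[%classic < +oo)%E.
Proof.
move=> s0; have [_ /(_ 1 ltr01) m1] := mPsi.
have e0 : 0 < 1 - expR (- s) by rewrite subr_gt0 -expR0 ltr_expR oppr_lt0.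
suff : ((1 - expR (- s))%:E * m `[s, +oo[%classic <= (Psi 1)%:E)%E.
  move=> h; rewrite ltNge; apply/negP; rewrite leye_eq => /eqP ms.
  by move: h; rewrite ms gt0_muley ?lte_fin// leye_eq.
rewrite m1 -integral_cst; last exact: measurable_itv.
apply: (@le_trans _ _ (\int[m]_(t in `[s, +oo[) (1 - expR (- (1 * t)))%:E)%E).
  apply: ge0_le_integral => //.
  - by move=> t _; rewrite lee_fin ltW.
  - by apply/measurable_EFinP/measurable_funTS.
  - move=> t /=; rewrite in_itv/= andbT => st.
    by rewrite lee_fin lerB// ler_expR lerN2 mul1r.
apply: ge0_subset_integral => //.
- by apply/measurable_EFinP/measurable_funTS.
- by move=> t; rewrite lee_fin; exact: one_sub_expR_ge0.
- by move=> t /=; rewrite !in_itv/= !andbT; exact: lt_le_trans.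
Qed.

Lemma bernstein_measure_sigma_finite : sigma_finite setT m.
Proof.
exists (fun k => [set t : R | t <= 0] `|` `[k.+1%:R^-1, +oo[%classic).
  apply/esym; rewrite -subTset => t _.
  have [t0|t0] := leP t 0; first by exists 0%N => //; left.
  have [k] := ltr_add_invr t0; rewrite add0r => kt.
  by exists k => //; right; rewrite /= in_itv/= ltW.
move=> k.
have m1 : measurable ([set t : R | t <= 0] : set (measurableTypeR R)).
  rewrite (_ : mkset _ = `]-oo, 0]%classic); first exact: measurable_itv.
  by apply/seteqP; split => x /=; rewrite in_itv.
have m2 : measurable (`[k.+1%:R^-1, +oo[%classic : set (measurableTypeR R)).
  exact: measurable_itv.
split; first exact: measurableU.
apply: (le_lt_trans (measureU2 _ m1 m2)).
apply: lte_add_pinfty; last exact: bernstein_tail_lty.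
by apply: (@le_lt_trans _ _ 0%E) => //; rewrite -(mPsi.1).
Qed.

(* [nu] is [m], presented as an image measure: a variable cannot be given a
   further structure, but an explicit construction can. *)
Let nu := measure_function_pushforward__canonical__measure_function_Measure m
  (@measurable_id _ (measurableTypeR R) setT).

Let ms : {sigma_finite_measure set (measurableTypeR R) -> \bar R} :=
  HB.pack_for (SigmaFiniteMeasure.type (measurableTypeR R) R) (Measure.sort nu)
    (Measure_isSigmaFinite.Build _ _ _ nu bernstein_measure_sigma_finite).

Variable d : nat.
Local Notation mu := (lebesgue_rV (R := R) d).

(** The jump kernel with values in the extended reals, where Tonelli's theorem
  applies before its finiteness is known. *)
Definition jump (r : R) : \bar R := (\int[m]_(t in pos) (heat d r t)%:E)%E.

Lemma jump_kernelE r : jump_kernel d m r = fine (jump r).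
Proof. by []. Qed.

Lemma jump_ge0 r : (0 <= jump r)%E.
Proof. by apply: integral_ge0 => t _; rewrite lee_fin heat_ge0. Qed.

Lemma measurable_heat_time r : measurable_fun (pos : set (measurableTypeR R)) (heat d r).
Proof.
apply: (eq_measurable_fun (fun t : R => (4 * pi * t) `^ (- (d%:R / 2)) *
    expR (- (r ^+ 2 * (4 * t) `^ (-1))))).
  move=> t; rewrite inE/= in_itv/= andbT => t0.
  by rewrite /heat powR_inv1// mulr_ge0// ltW.
apply: (@measurable_funTS _ _ (measurableTypeR R) R).
apply: measurable_funM.
  by apply: (@measurableT_comp _ _ _ _ _ _ (@powR R ^~ _)) => //; exact: measurable_funM.
apply: measurableT_comp => //; apply: measurableT_comp => //.
apply: measurable_funM => //.
by apply: (@measurableT_comp _ _ _ _ _ _ (@powR R ^~ _)) => //; exact: measurable_funM.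
Qed.

Lemma jump_anti r s : 0 <= r <= s -> (jump s <= jump r)%E.
Proof.
move=> rs; apply: ge0_le_integral => //.
- by move=> t _; rewrite lee_fin heat_ge0.
- by apply/measurable_EFinP; exact: measurable_heat_time.
- by apply/measurable_EFinP; exact: measurable_heat_time.
- move=> t /=; rewrite in_itv/= andbT => t0.
  by rewrite lee_fin heat_anti.
Qed.

Let K (p : measurableTypeR R * 'rV[R]_d) : R :=
  heat d (enorm p.2) p.1 * \1_pos (p.1 : R).

Let mK : measurable_fun setT K.
Proof. exact: measurable_heat2. Qed.

Let K0 p : 0 <= K p.
Proof. by rewrite mulr_ge0 ?heat_ge0. Qed.

Let integral_pos (f : R -> R) :
  (\int[m]_t (f t * \1_pos t)%:E = \int[m]_(t in pos) (f t)%:E)%E.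
Proof.
rewrite [RHS]integral_mkcond; apply: eq_integral => t _.
by rewrite patchE indicE; case: ifP; rewrite ?mulr1 ?mulr0.
Qed.

Lemma measurable_jump : measurable_fun setT (fun z : 'rV[R]_d => jump (enorm z)).
Proof.
have := @measurable_fun_fubini_tonelli_G _ _ (measurableTypeR R) 'rV[R]_d R ms
  (EFin \o K).
rewrite (_ : fubini_G _ _ = (fun z : 'rV[R]_d => jump (enorm z))); last first.
  by apply/funext => z; exact: integral_pos.
by apply; [exact/measurable_EFinP|move=> p; rewrite lee_fin].
Qed.

Let measurable_gK (g : 'rV[R]_d -> R) : measurable_fun setT g ->
  measurable_fun setT (fun p : measurableTypeR R * 'rV[R]_d => (g p.2 * K p)%:E).
Proof.
move=> mg; apply/measurable_EFinP/measurable_funM => //.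
exact: (measurableT_comp mg).
Qed.

Lemma measurable_integral_heat (g : 'rV[R]_d -> R) :
  measurable_fun setT g -> (forall z, 0 <= g z) ->
  measurable_fun (pos : set (measurableTypeR R))
    (fun t => \int[mu]_z (g z * heat d (enorm z) t)%:E)%E.
Proof.
move=> mg g0; have := @measurable_fun_fubini_tonelli_F _ _ (measurableTypeR R)
  'rV[R]_d R mu (fun p => (g p.2 * K p)%:E) (measurable_gK mg).
move=> /(_ (fun p => _)) h.
apply: (eq_measurable_fun (fubini_F mu (fun p => (g p.2 * K p)%:E))); last first.
  by apply: measurable_funTS; apply: h => p; rewrite lee_fin mulr_ge0.
move=> t tpos; apply: eq_integral => z _.
by rewrite /K/= indicE tpos mulr1.
Qed.

(** Tonelli: integrals against the jump kernel are mixtures over [m] of integrals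
  against the heat kernels, which are explicit. *)
Lemma integral_jump (g : 'rV[R]_d -> R) :
  measurable_fun setT g -> (forall z, 0 <= g z) ->
  (\int[mu]_z ((g z)%:E * jump (enorm z)) =
   \int[m]_(t in pos) \int[mu]_z (g z * heat d (enorm z) t)%:E)%E.
Proof.
move=> mg g0.
have := @fubini_tonelli _ _ (measurableTypeR R) 'rV[R]_d R ms mu
  (fun p => (g p.2 * K p)%:E).
move=> /(_ (measurable_gK mg) (fun p => _)) h.
transitivity (\int[mu]_z \int[ms]_t (g z * K (t, z))%:E)%E.
  apply: eq_integral => z _; rewrite /jump -(integral_pos (heat d (enorm z))).
  rewrite -ge0_integralZl//.
  - apply/measurable_EFinP.
    exact: (measurableT_comp mK (pair2_measurable z)).
  - by move=> t _; rewrite lee_fin; exact: (K0 (t, z)).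
  - by rewrite lee_fin.
rewrite -h; last by move=> p; rewrite lee_fin mulr_ge0.
rewrite [RHS]integral_mkcond; apply: eq_integral => t _.
rewrite patchE /K/= indicE; case: ifP => tpos.
  by apply: eq_integral => z _; rewrite mulr1.
by rewrite integral0_eq// => z _; rewrite !mulr0.
Qed.

End jump_kernel_integrals.

(** * Integrability of the jump kernel *)

Section jump_estimates.
Context {R : realType} (Psi : R -> R) (m : {measure set (measurableTypeR R) -> \bar R}).
Hypothesis mPsi : bernstein_measure Psi m.
Variable d : nat.
Local Notation pos := (`]0, +oo[%classic : set R).
Local Notation mu := (lebesgue_rV (R := R) d).
Local Notation J := (jump m d).
Local Notation j := (jump_kernel d m).

Let mpos : measurable (pos : set (measurableTypeR R)).
Proof. exact: measurable_itv. Qed.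

Let measurable_1exp (l : R) := measurable_one_sub_expR l.

(** The weight of Levy measures: [j (|z|) dz] may give infinite mass to the
  neighbourhoods of the origin, but it integrates this weight. *)
Definition levy_weight (z : 'rV[R]_d) : R := Num.min 1 (dotp z z).
Local Notation eta := levy_weight.

Lemma levy_weight_ge0 z : 0 <= eta z.
Proof. by rewrite le_min ler01 dotp_ge0. Qed.

Lemma levy_weight_gt0 z : z != 0 -> 0 < eta z.
Proof. by move=> z0; rewrite lt_min ltr01 dotp_gt0. Qed.

Lemma levy_weight0 : eta 0 = 0.
Proof.
rewrite /levy_weight /dotp big1; first by rewrite min_r.
by move=> i _; rewrite mxE mul0r.
Qed.

Lemma continuous_levy_weight (y : 'rV[R]_d) : continuous (fun x : 'rV[R]_d => eta (x - y)).
Proof.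
move=> x.
have := @continuous_min R 'rV[R]_d (cst 1) (fun x => dotp (x - y) (x - y)) x.
by apply; [exact: cst_continuous|exact: continuous_dotp].
Qed.

Lemma measurable_levy_weight : measurable_fun setT eta.
Proof.
apply: continuous_measurable_rV.
rewrite (_ : eta = (fun x : 'rV[R]_d => eta (x - 0))); first exact: continuous_levy_weight.
by apply/funext => x; rewrite subr0.
Qed.

(* The constant comes from comparing the heat kernels at times [t] and [2 t]. *)
Let C : R := 8 * 2 `^ (d%:R / 2).

Let C_gt0 : 0 < C.
Proof. by rewrite mulr_gt0// powR_gt0. Qed.

(** With [y = |z|^2 / (8 t)], this is [y * exp (- 2 y) <= exp (- y)]; it replaces
  the computation of the second moment of the Gaussian. *)
Lemma dotp_heat_le (z : 'rV[R]_d) t : 0 < t ->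
  dotp z z * heat d (enorm z) t <= C * t * heat d (enorm z) (2 * t).
Proof.
move=> t0; rewrite /heat sqr_enorm.
have -> : 4 * pi * (2 * t) = 2 * (4 * pi * t) by ring.
have p0 : 0 <= 4 * pi * t by rewrite !mulr_ge0// ?pi_ge0// ltW.
rewrite (@powRM _ 2 (4 * pi * t))// (powRN 2) /C.
set a := 2 `^ _; set b := _ `^ _.
have a0 : 0 < a by exact: powR_gt0.
set y := dotp z z / (4 * (2 * t)).
have -> : dotp z z / (4 * t) = y + y by rewrite /y; field; lra.
have -> : dotp z z = 8 * t * y by rewrite /y; field; lra.
have -> : 8 * a * t * (a^-1 * b * expR (- y)) = 8 * t * b * expR (- y).
  by field; rewrite gt_eqF.
have -> : 8 * t * y * (b * expR (- (y + y))) = 8 * t * b * (y * expR (- (y + y))) by ring.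
rewrite ler_wpM2l ?mulr_ge0 ?powR_ge0 ?(ltW t0)//.
rewrite opprD expRD mulrA ger_pMl ?expR_gt0// expRN ler_pdivrMr ?expR_gt0// mul1r.
by apply: le_trans (expR_ge1Dx _); rewrite lerDr.
Qed.

(** The left-hand side is at most [1] and at most [C * t], and
  [min 1 (C * t) <= (1 + C) * (t / (1 + t)) <= (1 + C) * (1 - exp (- t))]. *)
Lemma integral_levy_weight_heat t : 0 < t ->
  (\int[mu]_z (eta z * heat d (enorm z) t)%:E <=
   ((1 + C) * (1 - expR (- (1 * t))))%:E)%E.
Proof.
move=> t0; have meh s : measurable_fun setT (fun z => (eta z * heat d (enorm z) s)%:E).
  apply/measurable_EFinP; apply: measurable_funM; last exact: measurable_heat.
  exact: measurable_levy_weight.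
have mh s : measurable_fun setT (fun z : 'rV[R]_d => (heat d (enorm z) s)%:E).
  by apply/measurable_EFinP; exact: measurable_heat.
have h1 : (\int[mu]_z (eta z * heat d (enorm z) t)%:E <= 1)%E.
  rewrite -(integral_heat d t0); apply: ge0_le_integral => //.
  - by move=> z _; rewrite lee_fin mulr_ge0 ?levy_weight_ge0 ?heat_ge0.
  - move=> z _; rewrite lee_fin ler_piMl ?heat_ge0//.
    by rewrite /levy_weight ge_min lexx.
have h2 : (\int[mu]_z (eta z * heat d (enorm z) t)%:E <= (C * t)%:E)%E.
  have t20 : 0 < 2 * t by rewrite mulr_gt0.
  rewrite -[leRHS]mule1 -(integral_heat d t20) -ge0_integralZl//; last 2 first.
  - by move=> z _; rewrite lee_fin heat_ge0.
  - by rewrite lee_fin mulr_ge0// ltW.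
  apply: ge0_le_integral => //.
  - by move=> z _; rewrite lee_fin mulr_ge0 ?levy_weight_ge0 ?heat_ge0.
  - by apply: emeasurable_funM => //.
  - move=> z _; rewrite lee_fin; apply: le_trans (dotp_heat_le z t0).
    by rewrite ler_wpM2r ?heat_ge0// /levy_weight ge_min lexx orbT.
have ht : t / (1 + t) <= 1 - expR (- (1 * t)).
  by rewrite mul1r one_sub_expR_ge// ltW.
have C0 := C_gt0.
apply: (@le_trans _ _ ((1 + C) * (t / (1 + t)))%:E); last first.
  by rewrite lee_fin ler_wpM2l// addr_ge0// ltW.
have [tC|tC] := leP (C * t) 1.
  apply: (le_trans h2); rewrite lee_fin mulrA ler_pdivlMr; last by lra.
  rewrite [leLHS](_ : _ = t * (C + C * t)); last by ring.
  by rewrite [leRHS]mulrC ler_wpM2l ?(ltW t0)//; lra.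
apply: (le_trans h1); rewrite lee_fin mulrA ler_pdivlMr; lra.
Qed.

Lemma integral_levy_weight_jump :
  (\int[mu]_z ((eta z)%:E * J (enorm z)) <= ((1 + C) * Psi 1)%:E)%E.
Proof.
have C0 := C_gt0.
rewrite (integral_jump mPsi)//; last 2 first.
- exact: measurable_levy_weight.
- exact: levy_weight_ge0.
rewrite EFinM; have [_ ->//] := mPsi.
rewrite -ge0_integralZl//; last 3 first.
- by apply/measurable_EFinP/measurable_funTS.
- by move=> t tp; rewrite lee_fin one_sub_expR_ge0.
- by rewrite lee_fin; lra.
apply: ge0_le_integral => //.
- move=> t _; apply: integral_ge0 => z _.
  by rewrite lee_fin mulr_ge0 ?levy_weight_ge0 ?heat_ge0.
- by apply: measurable_integral_heat => //; [exact: measurable_levy_weight|exact: levy_weight_ge0].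
- by apply: emeasurable_funM => //; apply/measurable_EFinP/measurable_funTS.
- by move=> t; rewrite /= in_itv/= andbT => t0; rewrite -EFinM integral_levy_weight_heat.
Qed.


Lemma jump_kernel_ge0 r : 0 <= j r.
Proof. by rewrite jump_kernelE fine_ge0// jump_ge0. Qed.

Lemma jump_kernel_measurable : measurable_fun setT (fun z : 'rV[R]_d => j (enorm z)).
Proof.
apply: (@measurableT_comp _ _ _ _ _ _ (@fine R)) => //.
exact: (measurable_jump mPsi).
Qed.

Let measurable_levy_weight_jump :
  measurable_fun setT (fun z : 'rV[R]_d => ((eta z)%:E * J (enorm z))%E).
Proof.
apply: emeasurable_funM; last exact: (measurable_jump mPsi).
by apply/measurable_EFinP; exact: measurable_levy_weight.
Qed.

Let levy_weight_jump_ge0 z : (0 <= (eta z)%:E * J (enorm z))%E.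
Proof. by rewrite mule_ge0 ?jump_ge0// lee_fin levy_weight_ge0. Qed.

Lemma integrable_jump_kernel (f : 'rV[R]_d -> R) (c : R) :
  measurable_fun setT f -> (forall z, `|f z| <= c * eta z) ->
  mu.-integrable setT (fun z => (f z * j (enorm z))%:E).
Proof.
move=> mf fc.
have ieta : mu.-integrable setT (fun z => (eta z * j (enorm z))%:E).
  apply/integrableP; split.
    apply/measurable_EFinP; apply: measurable_funM; first exact: measurable_levy_weight.
    exact: jump_kernel_measurable.
  apply: (@le_lt_trans _ _ ((1 + C) * Psi 1)%:E); last exact: ltry.
  apply: le_trans integral_levy_weight_jump; apply: ge0_le_integral => //.
  - apply: measurableT_comp => //; apply/measurable_EFinP.
    apply: measurable_funM; first exact: measurable_levy_weight.
    exact: jump_kernel_measurable.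
  - move=> z _; rewrite gee0_abs ?lee_fin ?mulr_ge0 ?levy_weight_ge0 ?jump_kernel_ge0//.
    rewrite EFinM lee_wpmul2l ?lee_fin ?levy_weight_ge0// jump_kernelE.
    by have := jump_ge0 m d (enorm z); case: (J _) => //= _; rewrite leey.
apply: (@le_integrable _ _ _ _ _ _ _ (fun z => c%:E * (eta z * j (enorm z))%:E)%E) => //.
- apply/measurable_EFinP; apply: measurable_funM => //.
  exact: jump_kernel_measurable.
- move=> z _; rewrite -EFinM !abse_EFin lee_fin !normrM.
  rewrite (ger0_norm (levy_weight_ge0 _)) mulrA.
  rewrite ler_wpM2r// (le_trans (fc z))// ler_wpM2r ?levy_weight_ge0//.
  exact: ler_norm.
- exact: integrableZl.
Qed.

(** The kernel is finite almost everywhere, since [levy_weight * j] is integrable. *)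
Lemma integral_jump_kernel (S : set 'rV[R]_d) : measurable S -> ~ S 0 ->
  (\int[mu]_(z in S) (j (enorm z))%:E = \int[mu]_(z in S) J (enorm z))%E.
Proof.
move=> mS S0.
have ieta : mu.-integrable S (fun z => (eta z)%:E * J (enorm z))%E.
  apply: (@integrableS _ _ _ _ setT) => //; apply/integrableP; split => //.
  under eq_integral do rewrite gee0_abs//.
  exact: le_lt_trans integral_levy_weight_jump (ltry _).
apply: ge0_ae_eq_integral => //.
- by apply/measurable_EFinP/measurable_funTS; exact: jump_kernel_measurable.
- by apply: measurable_funTS; exact: (measurable_jump mPsi).
- by move=> z _; rewrite lee_fin jump_kernel_ge0.
- by move=> z _; rewrite jump_ge0.
have := integrable_ae mS ieta; apply: filterS => z /[swap] Sz /(_ Sz).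
have z0 : 0 < eta z.
  by apply: levy_weight_gt0; apply: contra_notN S0 => /eqP <-.
rewrite jump_kernelE; have := jump_ge0 m d (enorm z).
by case: (J _) => //= _; rewrite gt0_muley.
Qed.

End jump_estimates.

(** * Tails of the jump kernel *)

Section tail_estimate.
Context {R : realType} (Psi : R -> R) (m : {measure set (measurableTypeR R) -> \bar R}).
Hypothesis mPsi : bernstein_measure Psi m.
Variable d : nat.
Local Notation pos := (`]0, +oo[%classic : set R).
Local Notation mu := (lebesgue_rV (R := R) d).
Local Notation J := (jump m d).
Local Notation j := (jump_kernel d m).

Let mpos : measurable (pos : set (measurableTypeR R)).
Proof. exact: measurable_itv. Qed.

Let measurable_1exp (l : R) := measurable_one_sub_expR l.

(** Comparison of the integrands of [Psi l] and [Psi (L * l)]: below the time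
  [(L * l)^-1] one has [1 - exp (- l * t) <= l * t], which is at most
  [2 / L * (1 - exp (- L * l * t))]; beyond that time it is at most [1]. *)
Lemma bernstein_tail_ge (l L : R) : 0 < l -> 0 < L ->
  ((Psi l)%:E <= (2 / L * Psi (L * l))%R%:E + m `[((L * l)^-1)%R, +oo[%classic)%E.
Proof.
move=> l0 L0; have Ll0 : 0 < L * l by rewrite mulr_gt0.
have [_ PsiE] := mPsi; rewrite EFinM (PsiE _ l0) (PsiE _ Ll0).
set s := (L * l)^-1; have s0 : 0 < s by rewrite invr_gt0.
have -> : m `[s, +oo[%classic = (\int[m]_(t in pos) (\1_`[s, +oo[%classic t)%:E)%E.
  rewrite integral_indic; try exact: measurable_itv.
  congr (m _); apply/seteqP; split => [t|t []//] /=; rewrite !in_itv/= !andbT => st.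
  by split => //; exact: lt_le_trans st.
have ms : measurable (`[s, +oo[%classic : set (measurableTypeR R)).
  exact: measurable_itv.
have me k : measurable_fun (pos : set (measurableTypeR R))
    (fun t : R => (1 - expR (- (k * t)))%:E).
  by apply/measurable_EFinP/measurable_funTS.
rewrite -ge0_integralZl//; last 2 first.
- by move=> t tp; rewrite lee_fin one_sub_expR_ge0.
- by rewrite lee_fin divr_ge0// ltW.
rewrite -ge0_integralD//; last 3 first.
- by move=> t tp; rewrite mule_ge0// lee_fin ?one_sub_expR_ge0// divr_ge0// ltW.
- by apply: emeasurable_funM.
- by apply/measurable_EFinP.
apply: ge0_le_integral => //.
- by move=> t tp; rewrite lee_fin one_sub_expR_ge0.
- apply: emeasurable_funD; first exact: emeasurable_funM.
  by apply/measurable_EFinP.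
move=> t; rewrite /= in_itv/= andbT => t0.
rewrite -EFinM -EFinD lee_fin indicE.
have [st|ts] := leP s t.
  rewrite mem_set/=; last by rewrite in_itv/= st.
  rewrite -[leLHS]add0r lerD//.
    by rewrite mulr_ge0 ?divr_ge0 ?one_sub_expR_ge0//= ?ltW// in_itv/= t0.
  by rewrite lerBlDr lerDl expR_ge0.
rewrite memNset/=; last by rewrite in_itv/= andbT leNgt ts.
rewrite addr0.
(* on this range [L * l * t <= 1], where [1 - exp (- y)] is at least [y / 2] *)
have y1 : L * l * t <= 1.
  by rewrite -ler_pdivlMl// mulr1 ltW.
set y := L * l * t in y1 *.
have y0 : 0 <= y by rewrite mulr_ge0// ltW.
apply: (@le_trans _ _ (l * t)).
  by rewrite lerBlDl -lerBlDr; have := expR_ge1Dx (- (l * t)); lra.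
have -> : l * t = 2 / L * (y / 2) by rewrite /y; field; lra.
rewrite ler_wpM2l ?divr_ge0 ?(ltW L0)//.
apply: le_trans (one_sub_expR_ge y0).
by rewrite ler_wpM2l// lef_pV2 ?posrE; lra.
Qed.

(** The heat kernel at time [t >= s] is bounded by [(4 * pi * s) ^ (- d / 2)], hence
  puts at most half of its mass on a set of volume [V]. *)
Lemma integral_jump_setC_ge (E : set 'rV[R]_d) (V s : R) : measurable E ->
  0 < s -> (mu E <= V%:E)%E -> 2 * V <= (4 * pi * s) `^ (d%:R / 2) ->
  ((2^-1)%:E * m `[s, +oo[%classic <= \int[mu]_(z in ~` E) J (enorm z))%E.
Proof.
move=> mE s0 EV Vs.
have mC : measurable (~` E) by exact: measurableC.
have -> : (\int[mu]_(z in ~` E) J (enorm z) =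
    \int[mu]_z ((\1_(~` E) z)%:E * J (enorm z)))%E.
  rewrite [LHS]integral_mkcond; apply: eq_integral => z _.
  by rewrite patchE indicE; case: ifP; rewrite ?mul1e ?mul0e.
rewrite (integral_jump mPsi)//.
have ms : measurable (`[s, +oo[%classic : set (measurableTypeR R)).
  exact: measurable_itv.
rewrite -integral_cst//.
have mih : measurable_fun (pos : set (measurableTypeR R))
    (fun t => \int[mu]_z (\1_(~` E) z * heat d (enorm z) t)%:E)%E.
  by apply: measurable_integral_heat => //; exact: measurable_indic.
have sp : `[s, +oo[%classic `<=` pos.
  by move=> t /=; rewrite !in_itv/= !andbT; exact: lt_le_trans.
apply: (@le_trans _ _ (\int[m]_(t in `[s, +oo[%classic)
    \int[mu]_z (\1_(~` E) z * heat d (enorm z) t)%:E)%E); last first.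
  apply: ge0_subset_integral => // t _; apply: integral_ge0 => z _.
  by rewrite lee_fin mulr_ge0// heat_ge0.
apply: ge0_le_integral => //.
- by move=> t _; rewrite lee_fin.
- exact: measurable_funS mih.
move=> t /=; rewrite in_itv/= andbT => st.
have t0 : 0 < t by exact: lt_le_trans st.
have mh : measurable_fun setT (fun z : 'rV[R]_d => (heat d (enorm z) t)%:E).
  by apply/measurable_EFinP; exact: measurable_heat.
have -> : (\int[mu]_z (\1_(~` E) z * heat d (enorm z) t)%:E =
    \int[mu]_(z in ~` E) (heat d (enorm z) t)%:E)%E.
  rewrite [RHS]integral_mkcond; apply: eq_integral => z _.
  by rewrite patchE indicE; case: ifP; rewrite ?mul1r ?mul0r.
have := integral_heat d t0.
rewrite -(setUv E) ge0_integral_setU//; last 3 first.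
- exact: measurable_funS mh.
- by move=> z _; rewrite lee_fin heat_ge0.
- by apply/disj_setPS => z [].
have hE : (\int[mu]_(z in E) (heat d (enorm z) t)%:E <= (2^-1)%:E)%E.
  set P := (4 * pi * t) `^ (- (d%:R / 2)).
  apply: (@le_trans _ _ (\int[mu]_(z in E) (cst P%:E) z)%E).
    apply: ge0_le_integral => //.
    - by move=> z _; rewrite lee_fin heat_ge0.
    - exact: measurable_funS mh.
    - by move=> z _; rewrite lee_fin heat_le_peak.
  rewrite integral_cst//; apply: (@le_trans _ _ (P%:E * V%:E)%E).
    by rewrite lee_wpmul2l// lee_fin powR_ge0.
  rewrite -EFinM lee_fin /P powRN.
  rewrite ler_pdivrMl ?powR_gt0 ?mulr_gt0 ?pi_gt0//.
  suff : (4 * pi * s) `^ (d%:R / 2) <= (4 * pi * t) `^ (d%:R / 2).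
    by move=> h; rewrite ler_pdivlMr// mulrC (le_trans Vs).
  apply: ge0_ler_powR; rewrite ?divr_ge0 ?nnegrE ?mulr_ge0 ?pi_ge0 ?(ltW t0) ?(ltW s0)//.
  by rewrite ler_wpM2l// mulr_ge0// pi_ge0.
set a := (\int[mu]_(z in E) _)%E in hE *; set b := (\int[mu]_(z in ~` E) _)%E.
move=> ab; have {ab} : (a + b = 1)%E by exact: ab.
have : (0 <= a)%E by apply: integral_ge0 => z _; rewrite lee_fin heat_ge0.
have : (0 <= b)%E by apply: integral_ge0 => z _; rewrite lee_fin heat_ge0.
move: hE; case: a => [a| |]//; case: b => [b| |]//=; rewrite ?leey//.
by rewrite -EFinD !lee_fin => ha _ _ [ab]; lra.
Qed.

Lemma jump_gt0 r : Psi 1 != 0 -> (0 < J r)%E.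
Proof.
move=> Psi1; rewrite lt_neqAle jump_ge0 andbT eq_sym; apply: contra_neqN Psi1 => /eqP Jr.
have mh : measurable_fun (pos : set (measurableTypeR R)) (fun t => (heat d r t)%:E).
  by apply/measurable_EFinP; exact: measurable_heat_time.
have : ae_eq m pos (fun t => (heat d r t)%:E) (cst 0%E).
  apply/ae_eq_integral_abs => //; rewrite -[RHS]Jr; apply: eq_integral => t _.
  by rewrite gee0_abs// lee_fin heat_ge0.
move=> h0; have [_ /(_ 1 ltr01) PsiE] := mPsi.
apply: EFin_inj; rewrite PsiE -[RHS](integral0 m pos).
apply: ae_eq_integral => //.
  by apply/measurable_EFinP/measurable_funTS.
move: h0; apply: filterS => t h tp; have := h tp.
move: tp; rewrite /= in_itv/= andbT => t0 [h0].
by have := @heat_gt0 R d r t t0; rewrite h0 ltxx.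
Qed.

End tail_estimate.

Section nonlocal_tail.
Context {R : realType} (Psi : R -> R) (m : {measure set (measurableTypeR R) -> \bar R}).
Hypothesis mPsi : bernstein_measure Psi m.
Variable d : nat.
Local Notation mu := (lebesgue_rV (R := R) d).
Local Notation J := (jump m d).
Local Notation j := (jump_kernel d m).

Lemma bernstein_measure_ge0 (l : R) : 0 < l -> 0 <= Psi l.
Proof.
move=> l0; have [_ /(_ _ l0) PsiE] := mPsi.
rewrite -lee_fin PsiE; apply: integral_ge0 => t.
rewrite /= in_itv/= andbT => t0.
by rewrite lee_fin subr_ge0 -expR0 ler_expR oppr_le0 mulr_ge0// ltW.
Qed.

Lemma weak_scaling_bernstein1_gt0 : weak_scaling Psi -> 0 < Psi 1.
Proof.
move=> [a1 [a2 [b1 [a10 a12 a21 b11 sc]]]].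
rewrite lt_neqAle bernstein_measure_ge0// andbT; apply/eqP => Psi1.
have /andP[+ _] := sc 1 1 (lexx _) (lexx _).
by rewrite -Psi1 invr0 mulr0 divr1 powR1 mulr1 invr_le0; lra.
Qed.

(** With [L] so large that the upper scaling, of exponent [a2 < 1], makes
  [2 / L * Psi (L * l)] at most half of [Psi l], the previous comparison bounds
  the tail of [m] below by [Psi l / 2], and the lower scaling bounds [Psi l]
  below by a power of [l]. *)
Lemma bernstein_tail_power : weak_scaling Psi ->
  exists a L k : R, [/\ 0 < a, a < 1, 0 < L, 0 < k &
    forall s, 0 < s -> L * s <= 1 ->
      ((k * s `^ (- a))%:E <= m `[s, +oo[%classic)%E].
Proof.
move=> ws; have Psi1 := weak_scaling_bernstein1_gt0 ws.
have [a1 [a2 [b1 [a10 a12 a21 b11 sc]]]] := ws.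
pose L : R := (4 * b1) `^ (1 - a2)^-1.
have L0 : 0 < L by apply: powR_gt0; lra.
have L1 : 1 <= L.
  have e1 : 1 `^ (1 - a2)^-1 = 1 :> R by rewrite powR1.
  rewrite -[leLHS]e1; apply: ge0_ler_powR; rewrite ?nnegrE//; last 2 first.
  - by lra.
  - by lra.
  - by rewrite invr_ge0; lra.
exists a1, L, (2^-1 * (Psi 1 / b1) * L `^ (- a1)); split => //.
- by lra.
- by rewrite !mulr_gt0 ?powR_gt0 ?invr_gt0; lra.
move=> s s0 Ls.
pose l := (L * s)^-1.
have Ls0 : 0 < L * s by rewrite mulr_gt0.
have l1 : 1 <= l by rewrite invf_ge1.
have l0 : 0 < l by lra.
have -> : s = (L * l)^-1 by rewrite /l; field; rewrite !gt_eqF.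
have Psil : Psi 1 / b1 * l `^ a1 <= Psi l.
  have /andP[+ _] := sc 1 l (lexx _) l1.
  rewrite divr1 ler_pdivlMr// => h; apply: le_trans h.
  by rewrite [leLHS](_ : _ = b1^-1 * l `^ a1 * Psi 1)//; ring.
have Psil0 : 0 < Psi l.
  by apply: lt_le_trans Psil; rewrite mulr_gt0 ?divr_gt0 ?powR_gt0//; lra.
have PsiL : 2 / L * Psi (L * l) <= 2^-1 * Psi l.
  have lLl : l <= L * l by rewrite ler_peMl// ltW.
  have /andP[_] := sc l (L * l) l1 lLl.
  rewrite mulfK ?gt_eqF// ler_pdivrMr// => h.
  apply: (@le_trans _ _ (2 / L * (b1 * L `^ a2 * Psi l))).
    by rewrite ler_wpM2l// divr_ge0// ltW.
  have La : L `^ a2 = L / (4 * b1).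
    rewrite (_ : a2 = 1 - (1 - a2)); last by ring.
    rewrite powRB; last by rewrite (gt_eqF L0) implybT.
    rewrite powRr1 ?(ltW L0)//; congr (_ / _).
    by rewrite /L -powRrM mulVf ?powRr1//; lra.
  rewrite La [leLHS](_ : _ = 2^-1 * Psi l)//; field.
  by rewrite !gt_eqF//; lra.
have := bernstein_tail_ge mPsi l0 L0.
set M := m _.
have : (0 <= M)%E by exact: measure_ge0.
case: M => [M| |]//= _; rewrite ?leey// -EFinD !lee_fin => h.
have -> : (L * l)^-1 `^ (- a1) = L `^ a1 * l `^ a1.
  rewrite -powR_inv1 ?mulr_ge0 ?(ltW L0) ?(ltW l0)// -powRrM mulN1r opprK.
  by rewrite powRM ?(ltW L0) ?(ltW l0).
have -> : 2^-1 * (Psi 1 / b1) * L `^ (- a1) * (L `^ a1 * l `^ a1) = 2^-1 * (Psi 1 / b1 * l `^ a1).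
  by rewrite powRN; field; rewrite !gt_eqF ?powR_gt0//; lra.
by lra.
Qed.

(** Sets of bounded radius all miss one and the same unit cube, on which [j] is
  bounded below. *)
Lemma jump_farther (r : R) : 0 <= r -> Psi 1 != 0 -> (0 < d)%N ->
  exists2 k : R, 0 < k & forall E : set 'rV[R]_d, measurable E ->
    (forall z, E z -> enorm z <= r) ->
    (k%:E <= \int[mu]_(z in ~` E) J (enorm z))%E.
Proof.
move=> r0 Psi1; case: d => // n _.
pose A : set 'rV[R]_n.+1 := [set z | forall i, `]r, r + 1[%classic (z ord0 i)].
have mA : measurable A by exact: (@measurable_box _ _ (fun=> `]r, r + 1[%classic)).
have muA : lebesgue_rV n.+1 A = 1%E.
  rewrite (@lebesgue_rV_box _ _ (fun=> `]r, r + 1[%classic))//.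
  rewrite big1// => i _; rewrite lebesgue_measure_itv/= lte_fin ltrDl ltr01.
  by rewrite -EFinB addrC addrA addNr add0r.
pose rho := enorm (const_mx (r + 1) : 'rV[R]_n.+1).
have Jrho : (0 < jump m n.+1 rho)%E by exact: (jump_gt0 mPsi).
have [k k0 kJ] : exists2 k : R, 0 < k & (k%:E <= jump m n.+1 rho)%E.
  move: Jrho; case: (jump _ _ _) => [k| |]//; first by rewrite lte_fin => k0; exists k.
  by exists 1 => //; rewrite leey.
exists k => // E mE Er.
have AE : A `<=` ~` E.
  move=> z Az /Er zr; have := Az ord0; rewrite /= in_itv/= => /andP[rz _].
  have := lt_le_trans rz (le_trans (ler_norm _) (le_trans (coord_le_enorm z ord0) zr)).
  by rewrite ltxx.
have mJ := @measurable_jump _ _ _ mPsi n.+1.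
apply: (@le_trans _ _ (\int[lebesgue_rV n.+1]_(z in A) jump m n.+1 (enorm z))%E); last first.
  apply: (ge0_subset_integral _ mA (measurableC mE)) AE.
  - exact: measurable_funTS.
  - by move=> z _; rewrite jump_ge0.
rewrite -[leLHS]mule1 -muA -(integral_cst _ mA).
apply: ge0_le_integral; first exact: mA.
- by move=> z _; rewrite lee_fin ltW.
- exact: measurable_cst.
- exact: measurable_funTS.
move=> z Az; apply: (le_trans kJ); apply: jump_anti; rewrite enorm_ge0/=.
apply: ler_wsqrtr; apply: ler_sum => i _; rewrite !mxE.
have := Az i; rewrite /= in_itv/= => /andP[rz zr].
by rewrite ler_pM// ?ltW//; lra.
Qed.

(** Outside a set of volume at most [V] there remains Levy mass at least of order
  [V ^ (- 1 / p)]. The exponent [p = d / (2 * a)] balances the volume [V] with the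
  time [s] at which the heat kernel spreads over a set of that volume, so that
  [s] is of order [V ^ (2 / d)]. For large [V] the bound only has to be positive,
  and it is there that the radius [r] enters. *)
Lemma nonlocal_tail (r : R) : (2 <= d)%N -> weak_scaling Psi ->
  exists p K : R, [/\ 1 <= p, 0 < K &
    forall (E : set 'rV[R]_d) (V : R), measurable E ->
      0 < V -> (mu E <= V%:E)%E -> (forall z, E z -> enorm z <= r) ->
      (1 <= (K * V `^ p^-1)%:E * \int[mu]_(z in ~` E) J (enorm z))%E].
Proof.
move=> d2 ws; have d0 : (0 < d)%N by exact: leq_trans d2.
have dR : 2 <= d%:R :> R by rewrite (ler_nat R 2 d).
have Psi1 := weak_scaling_bernstein1_gt0 ws.
have [a [L [k [a0 a1 L0 k0 tail]]]] := bernstein_tail_power ws.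
have [k' k'0 far] : exists2 k' : R, 0 < k' & forall E : set 'rV[R]_d, measurable E ->
    (forall z, E z -> enorm z <= r) ->
    (k'%:E <= \int[mu]_(z in ~` E) J (enorm z))%E.
  have [k' k'0 far] := jump_farther (normr_ge0 r) (lt0r_neq0 Psi1) d0.
  exists k' => // E mE Er; apply: far => // z /Er zr.
  exact: le_trans zr (ler_norm _).
pose p : R := d%:R / (2 * a).
have p0 : 0 < p by rewrite divr_gt0//; lra.
have pV : p^-1 = 2 / d%:R * a by rewrite /p; field; lra.
(* the two regimes meet at volume [V0] *)
pose V0 := 2^-1 * (4 * pi * L^-1) `^ (d%:R / 2).
have V00 : 0 < V0 by rewrite mulr_gt0// powR_gt0// !mulr_gt0 ?pi_gt0 ?invr_gt0.
pose k1 := 2^-1 * k * 2 `^ (- p^-1).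
have k10 : 0 < k1 by rewrite !mulr_gt0 ?powR_gt0.
exists p, (k1^-1 + (k' * V0 `^ p^-1)^-1); split.
- by rewrite ler_pdivlMr; lra.
- by rewrite addr_gt0 ?invr_gt0 ?mulr_gt0 ?powR_gt0.
move=> E V mE V_gt0 EV Er.
set tau := (\int[mu]_(z in _) _)%E.
have tau0 : (0 <= tau)%E by apply: integral_ge0 => z _; exact: jump_ge0.
have Vp0 : 0 < V `^ p^-1 by rewrite powR_gt0.
have bnd c : 0 < c -> (c%:E <= tau)%E ->
    1 <= (k1^-1 + (k' * V0 `^ p^-1)^-1) * V `^ p^-1 * c ->
    (1 <= ((k1^-1 + (k' * V0 `^ p^-1)^-1) * V `^ p^-1)%:E * tau)%E.
  move=> c0 ctau h; apply: (@le_trans _ _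
    (((k1^-1 + (k' * V0 `^ p^-1)^-1) * V `^ p^-1)%:E * c%:E)%E).
    by rewrite -EFinM lee_fin.
  rewrite lee_wpmul2l// lee_fin mulr_ge0 ?(ltW Vp0)// addr_ge0// invr_ge0 ltW//.
  by rewrite mulr_gt0// powR_gt0.
pose s := (2 * V) `^ (2 / d%:R) / (4 * pi).
have pi4 : 1 <= 4 * pi :> R by have := pi_ge2 R; lra.
have V20 : 0 < 2 * V by lra.
have s0 : 0 < s by rewrite divr_gt0 ?powR_gt0//; lra.
have Vs : 2 * V = (4 * pi * s) `^ (d%:R / 2).
  rewrite /s mulrCA mulfV ?mulr1; last by lra.
  rewrite -powRrM (_ : 2 / d%:R * (d%:R / 2) = 1); last by field; lra.
  by rewrite powRr1// ltW.
have [Ls|Ls] := leP (L * s) 1.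
  have sa : s `^ a <= 2 `^ p^-1 * V `^ p^-1.
    rewrite -powRM ?(ltW V_gt0)// pV powRrM.
    apply: ge0_ler_powR; rewrite ?nnegrE ?(ltW a0) ?(ltW s0) ?powR_ge0//.
    by rewrite /s ler_piMr ?powR_ge0// invf_le1//; lra.
  have c0 : 0 < 2^-1 * (k * s `^ (- a)) by rewrite !mulr_gt0 ?powR_gt0.
  apply: (bnd _ c0).
    apply: le_trans (integral_jump_setC_ge mPsi mE s0 EV _); last by rewrite -Vs.
    by rewrite EFinM lee_wpmul2l// tail.
  apply: (@le_trans _ _ (k1^-1 * V `^ p^-1 * (2^-1 * (k * s `^ (- a))))).
    have -> : k1^-1 * V `^ p^-1 * (2^-1 * (k * s `^ (- a))) =
        2 `^ p^-1 * V `^ p^-1 / s `^ a.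
      by rewrite /k1 !powRN; field; rewrite !gt_eqF ?powR_gt0.
    by rewrite ler_pdivlMr ?powR_gt0// mul1r.
  rewrite ler_wpM2r ?(ltW c0)// ler_wpM2r ?(ltW Vp0)// lerDl invr_ge0 ltW//.
  by rewrite mulr_gt0// powR_gt0.
apply: (bnd _ k'0); first exact: far.
have VV0 : V0 <= V.
  rewrite -(ler_pM2l (ltr0n R 2)) Vs /V0 mulrA mulfV ?mul1r//.
  have pi40 : 0 <= 4 * pi :> R by lra.
  have Lsl : 4 * pi * L^-1 <= 4 * pi * s.
    by rewrite ler_wpM2l// -[leLHS]mulr1 ler_pdivrMl// ltW.
  have L40 : 0 <= 4 * pi * L^-1 by rewrite mulr_ge0// invr_ge0 ltW.
  apply: ge0_ler_powR; rewrite ?nnegrE//.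
  exact: le_trans Lsl.
have V0p : V0 `^ p^-1 <= V `^ p^-1.
  apply: ge0_ler_powR; rewrite ?nnegrE ?invr_ge0 ?(ltW p0) ?(ltW V00) //.
  exact: ltW.
apply: (@le_trans _ _ ((k' * V0 `^ p^-1)^-1 * V `^ p^-1 * k')).
  rewrite invfM mulrAC [X in X * _]mulrAC mulVf ?gt_eqF// mul1r mulrC.
  by rewrite ler_pdivlMr ?powR_gt0// mul1r.
by rewrite ler_wpM2r ?(ltW k'0)// ler_wpM2r ?(ltW Vp0)// lerDr invr_ge0 ltW.
Qed.

End nonlocal_tail.

(** * Monotonicity and reflections *)

Section jump_monotone.
Context {R : realType} (Psi : R -> R) (m : {measure set (measurableTypeR R) -> \bar R}).
Hypothesis mPsi : bernstein_measure Psi m.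
Variable d : nat.

(** An infinite value at [r] would propagate to the ball of radius [r], against the
  local integrability of [levy_weight z * jump (enorm z)]. *)
Lemma jump_lty (r : R) : (0 < d)%N -> 0 < r -> (jump m d r < +oo)%E.
Proof.
case: d => // n _ r0.
pose c := r / (2 * n.+1%:R).
have c0 : 0 < c by rewrite divr_gt0// mulr_gt0.
pose A : set 'rV[R]_n.+1 := [set z | forall i, `]c, 2 * c[%classic (z ord0 i)].
have mA : measurable A by exact: (@measurable_box _ _ (fun=> `]c, 2 * c[%classic)).
have muA : (0 < lebesgue_rV n.+1 A)%E.
  rewrite (@lebesgue_rV_box _ _ (fun=> `]c, 2 * c[%classic))//.
  rewrite (eq_bigr (fun=> c%:E)); last first.
    move=> i _; rewrite lebesgue_measure_itv/= lte_fin ifT; last by lra.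
    by rewrite -EFinB; congr (_%:E); ring.
  by rewrite prodEFin lte_fin; apply: prodr_gt0.
have iJ : (lebesgue_rV n.+1).-integrable setT
    (fun z => (levy_weight z)%:E * jump m n.+1 (enorm z))%E.
  apply/integrableP; split.
    apply: emeasurable_funM; last exact: (measurable_jump mPsi).
    by apply/measurable_EFinP; exact: measurable_levy_weight.
  under eq_integral do rewrite gee0_abs ?mule_ge0 ?jump_ge0 ?lee_fin ?levy_weight_ge0//.
  exact: le_lt_trans (integral_levy_weight_jump mPsi _) (ltry _).
have [N [mN N0 JN]] := integrable_ae measurableT iJ.
rewrite ltNge leye_eq; apply/negP => /eqP Jr.
suff AN : A `<=` N.
  have : (lebesgue_rV n.+1 A <= lebesgue_rV n.+1 N)%E by apply: le_measure; rewrite ?inE.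
  by rewrite N0 leNgt muA.
move=> z Az; apply: JN => /= /(_ I).
have zc i : c < z ord0 i < 2 * c by have := Az i; rewrite /= in_itv.
have z0 : z != 0.
  by apply: contraTneq (zc ord0) => ->; rewrite mxE; apply/negP; lra.
have zr : enorm z <= r.
  have nn : 0 < n.+1%:R :> R by rewrite ltr0n.
  have n1 : 1 <= n.+1%:R :> R by rewrite ler1n.
  rewrite -(ger0_norm (ltW r0)) -sqrtr_sqr; apply: ler_wsqrtr.
  apply: (@le_trans _ _ (\sum_(i < n.+1) (2 * c) ^+ 2)).
    apply: ler_sum => i _; have /andP[zi1 zi2] := zc i.
    by rewrite expr2 ler_pM// ltW//; lra.
  rewrite sumr_const card_ord -[leLHS]mulr_natr.
  have -> : 2 * c = r / n.+1%:R by rewrite /c; field; rewrite gt_eqF.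
  rewrite expr_div_n mulrAC ler_pdivrMr ?exprn_gt0// ler_wpM2l ?sqr_ge0//.
  by rewrite expr2 ler_peMr// ltW.
have : (jump m n.+1 (enorm z) = +oo)%E.
  apply/eqP; rewrite -leye_eq -Jr; apply: jump_anti.
  by rewrite enorm_ge0.
by move=> ->; rewrite gt0_muley// lte_fin levy_weight_gt0.
Qed.

Lemma jump_kernel_anti (r s : R) : (0 < d)%N -> 0 < r -> r <= s ->
  jump_kernel d m s <= jump_kernel d m r.
Proof.
move=> d0 r0 rs; rewrite !jump_kernelE; apply: fine_le.
- by rewrite ge0_fin_numE ?jump_ge0// jump_lty// (lt_le_trans r0).
- by rewrite ge0_fin_numE ?jump_ge0// jump_lty.
- by apply: jump_anti; rewrite (ltW r0).
Qed.

End jump_monotone.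

Section reflection_lemmas.
Context {R : realType} {d : nat}.
Variables (e : 'rV[R]_d) (lam : R).
Hypothesis e1 : enorm e = 1.
Implicit Types x y z : 'rV[R]_d.

Let ee : dotp e e = 1.
Proof. by rewrite -sqr_enorm e1 expr1n. Qed.

Lemma dotp_reflection x : dotp (reflection e lam x) e = 2 * lam - dotp x e.
Proof. by rewrite dotpDl dotpBl !dotpZl ee; ring. Qed.

Let L x := x - (2 * dotp x e) *: e.

Let LD : {morph L : x y / x + y}.
Proof.
move=> x y; rewrite /L dotpDl mulrDr scalerDl.
by rewrite opprD addrACA.
Qed.

Let dotpLe x : dotp (L x) e = - dotp x e.
Proof. by rewrite dotpBl dotpZl ee; ring. Qed.

Let LK : involutive L.
Proof.
by move=> x; rewrite {1}/L dotpLe mulrN scaleNr opprK /L subrK.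
Qed.

Let enormL x : enorm (L x) = enorm x.
Proof.
rewrite /enorm; congr Num.sqrt.
by rewrite {2}/L dotpBr dotpZr dotpLe dotpBl dotpZl (dotpC e x); ring.
Qed.

Let mL : measurable_fun setT L.
Proof.
apply: measurable_rV_add; first exact: measurable_id.
apply: measurable_rV_opp; apply/measurable_fun_rVP => i.
rewrite (_ : _ \o _ = (fun x => 2 * dotp x e * e ord0 i)).
  apply: measurable_funM => //; apply: measurable_funM => //.
  by apply: continuous_measurable_rV; exact: continuous_dotpl.
by apply/funext => x /=; rewrite /rV_coord mxE.
Qed.

Lemma reflectionK : involutive (reflection e lam).
Proof.
move=> x; rewrite {1}/reflection dotp_reflection /reflection.
apply/rowP => i; rewrite !mxE; ring.
Qed.

Let reflectionD x z : reflection e lam (x + z) = L z + reflection e lam x.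
Proof.
rewrite /reflection /L dotpDl; apply/rowP => i; rewrite !mxE; ring.
Qed.

Lemma measure_preserving_reflection x :
  measure_preserving (fun z => reflection e lam (x + z) - x).
Proof.
rewrite (_ : (fun z => _) = (fun z => z + (reflection e lam x - x)) \o L).
  apply: measure_preserving_comp; first exact: measure_preserving_shift.
  exact: measure_preserving_isometry.
by apply/funext => z; rewrite reflectionD -addrA.
Qed.

(** The squares of the two sides differ by
  [4 * (dotp y e - lam) * (dotp x e - lam)]. *)
Lemma enorm_sub_reflection x y : lam <= dotp x e -> lam <= dotp y e ->
  enorm (y - x) <= enorm (reflection e lam y - x).
Proof.
move=> xe ye; apply: ler_wsqrtr.
pose a := dotp y e - lam.
have -> : reflection e lam y - x = (y - x) - (2 * a) *: e.
  by rewrite /reflection /a; apply/rowP => i; rewrite !mxE; ring.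
have we : dotp (y - x) e = dotp y e - dotp x e by exact: dotpBl.
move: (y - x) we => w we.
rewrite [leRHS]dotpBr dotpZr !(dotpBl w) !dotpZl ee (dotpC e) we.
rewrite [leRHS](_ : _ = dotp w w + 4 * (a * (dotp x e - lam))).
  by rewrite lerDl mulr_ge0// mulr_ge0 /a; lra.
by rewrite /a; ring.
Qed.

End reflection_lemmas.

(** * Test functions *)

Section quadratic.
Context {R : realType} {d : nat}.
Implicit Types x y z v : 'rV[R]_d.

Lemma is_derive_quadratic_on_line (v y : 'rV[R]_d) (f : 'rV[R]_d -> R) (l b : R) :
  (forall h : R, f (h *: v + y) - f y = h * l + h ^+ 2 * b) -> is_derive y v f l.
Proof.
move=> fE.
have lim : h^-1 *: ((f \o shift y) (h *: v) - f y) @[h --> 0^'] --> l.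
  have : (fun h : R => l + h * b) @ 0^' --> l + 0 * b.
    apply: cvg_within_filter; apply: cvgD; first exact: cvg_cst.
    by apply: cvgM; [exact: cvg_id|exact: cvg_cst].
  rewrite mul0r addr0; apply: cvg_trans; apply: near_eq_cvg; near=> h.
  have h0 : h != 0 by near: h; exact: nbhs_dnbhs_neq.
  by rewrite /= fE /GRing.scale/=; field.
split; first by apply/cvg_ex; exists l.
exact: cvg_lim.
Unshelve. all: by end_near. Qed.

Lemma is_derive_sq_dist x (k eps : R) y i :
  is_derive y (ebase i) (fun z => k - eps * dotp (z - x) (z - x))
    (- (2 * eps) * (y - x) ord0 i).
Proof.
apply: (is_derive_quadratic_on_line (b := - eps)) => h.
have dE z : dotp z (ebase i : 'rV[R]_d) = z ord0 i.
  rewrite /dotp (bigD1 i)//= big1 ?addr0; first by rewrite mxE !eqxx mulr1.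
  by move=> j ji; rewrite mxE (negbTE ji) andbF mulr0.
have -> : h *: ebase i + y - x = (y - x) + h *: ebase i by rewrite -addrA addrC.
move: (y - x) => w; rewrite dotpDl !dotpDr !dotpZl !dotpZr (dotpC (ebase i)) !dE.
by rewrite [ebase i _ _]mxE !eqxx /=; ring.
Qed.

Lemma is_derive_coord x (k : R) y i j :
  is_derive y (ebase j) (fun z => k * (z - x) ord0 i) (k * (i == j)%:R).
Proof.
apply: (is_derive_quadratic_on_line (b := 0)) => h.
by rewrite !mxE eqxx /=; ring.
Qed.

Lemma C2_near_paraboloid (phi : 'rV[R]_d -> R) x (k eps : R) (U : set 'rV[R]_d) :
  open U -> U x -> (forall y, U y -> phi y = k - eps * dotp (y - x) (y - x)) ->
  C2_near phi x.
Proof.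
move=> oU Ux phiE.
have nU y : U y -> \forall z \near y, U z by move=> Uy; exact: open_nbhs_nbhs.
have D1 y i : U y -> is_derive y (ebase i) phi (- (2 * eps) * (y - x) ord0 i).
  move=> Uy; apply: near_eq_is_derive (is_derive_sq_dist x k eps y i).
  by apply: filterS (nU _ Uy) => z Uz; rewrite phiE.
have D1E y i : U y -> 'D_(ebase i) phi y = - (2 * eps) * (y - x) ord0 i.
  by move=> /(D1 _ i) ?; exact: derive_val.
have D2 y i j : U y ->
    is_derive y (ebase j) ('D_(ebase i) phi) (- (2 * eps) * (i == j)%:R).
  move=> Uy; apply: near_eq_is_derive (is_derive_coord x _ y i j).
  by apply: filterS (nU _ Uy) => z Uz; rewrite D1E.
have D2E y i j : U y -> 'D_(ebase j) ('D_(ebase i) phi) y = - (2 * eps) * (i == j)%:R.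
  by move=> /(D2 _ i j) ?; exact: derive_val.
have nx := nU _ Ux; apply: filterS nx => y Uy i j; split.
- by case: (D1 y i Uy).
- rewrite /prop_for /continuous_at D1E//.
  apply: (@cvg_trans _ ((fun z : 'rV[R]_d => - (2 * eps) * (z - x) ord0 i) @ y)).
    by apply: (@near_eq_cvg _ _ _ (nbhs_filter y)); apply: filterS (nU _ Uy) => z Uz; rewrite D1E.
  apply: (@cvgM _ _ _ (nbhs_filter y)); first exact: (@cvg_cst _ _ _ _ (nbhs_filter y)).
  apply: (@cvg_coordB _ _ _ _ (nbhs_filter y) id).
  exact: (@coord_continuous R _ _ ord0 i y).
- by case: (D2 y i j Uy).
- rewrite /prop_for /continuous_at D2E//.
  apply: (@cvg_trans _ ((fun=> - (2 * eps) * (i == j)%:R) @ y)).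
    by apply: (@near_eq_cvg _ _ _ (nbhs_filter y)); apply: filterS (nU _ Uy) => z Uz; rewrite D2E.
  exact: (@cvg_cst _ _ _ _ (nbhs_filter y)).
Qed.

End quadratic.

Section cutoff.
Context {R : realType} {d : nat}.
Local Notation eta := (@levy_weight R d).

(** The sublevels of [levy_weight (y - x)] are a basis of neighbourhoods of [x];
  measuring neighbourhoods this way makes the bounds required of the integrands
  immediate. *)
Lemma levy_weight_nbhs (E : set 'rV[R]_d) x : open E -> E x ->
  exists q : R, [/\ 0 < q, q <= 1 & forall y, eta (y - x) < q -> E y].
Proof.
move=> oE Ex; have /nbhs_ballP[r /= r0 rE] : nbhs x E by exact: open_nbhs_nbhs.
exists (Num.min 1 (r ^+ 2)); split.
- by rewrite lt_min ltr01 exprn_gt0.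
- by rewrite ge_min lexx.
move=> y; rewrite /levy_weight lt_min !gt_min ltxx/= => /andP[h1 h2].
apply: rE; rewrite -ball_normE /ball_/=; apply/(mx_norm_ltP _ r0) => i.
have yx : dotp (y - x) (y - x) < r ^+ 2.
  by case/orP: h2 => // h2; exact: lt_trans h1 h2.
rewrite -(ltr_pXn2r (n := 2)) ?nnegrE ?(ltW r0)// real_normK ?num_real//.
apply: le_lt_trans yx; apply: le_trans (sqr_coord_le_dotp (y - x) i).
by rewrite !mxE -sqrrN opprB.
Qed.

Definition cutoff (q : R) (z : 'rV[R]_d) : R :=
  Num.min 1 (Num.max 0 (2 / q * eta z - 1)).

Variables (q : R) (q0 : 0 < q).

Lemma cutoff_ge0 z : 0 <= cutoff q z.
Proof. by rewrite le_min ler01 le_max lexx. Qed.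

Lemma cutoff_le1 z : cutoff q z <= 1.
Proof. by rewrite ge_min lexx. Qed.

Lemma cutoff_le z : cutoff q z <= 2 / q * eta z.
Proof.
rewrite /cutoff ge_min; apply/orP; right; rewrite ge_max; apply/andP; split.
  by rewrite mulr_ge0 ?divr_ge0 ?levy_weight_ge0// ltW.
by rewrite gerBl.
Qed.

Lemma cutoff_eq0 z : eta z <= q / 2 -> cutoff q z = 0.
Proof.
move=> zq; rewrite /cutoff max_l; first by rewrite min_r.
by rewrite subr_le0 mulrAC ler_pdivrMr//; lra.
Qed.

Lemma cutoff_eq1 z : q <= eta z -> cutoff q z = 1.
Proof.
move=> qz; have h : 1 <= 2 / q * eta z - 1.
  by rewrite lerBrDr mulrAC ler_pdivlMr//; lra.
by rewrite /cutoff max_r ?min_l// (le_trans _ h).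
Qed.

Lemma continuous_cutoff (x : 'rV[R]_d) : continuous (fun y : 'rV[R]_d => cutoff q (y - x)).
Proof.
move=> y.
have h : {for y, continuous (fun y : 'rV[R]_d => 2 / q * eta (y - x) - 1)}.
  apply: (@cvgB _ _ _ _ (nbhs_filter y)); last exact: (@cvg_cst _ _ _ _ (nbhs_filter y)).
  apply: (@cvgM _ _ _ (nbhs_filter y)); first exact: (@cvg_cst _ _ _ _ (nbhs_filter y)).
  exact: continuous_levy_weight.
have := @continuous_min R 'rV[R]_d (cst 1)
  (fun y => Num.max 0 (2 / q * eta (y - x) - 1)) y.
apply; first exact: cst_continuous.
have := @continuous_max R 'rV[R]_d (cst 0) (fun y => 2 / q * eta (y - x) - 1) y.
by apply; first exact: cst_continuous.
Qed.

End cutoff.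

(** * Testing the equation at a negative minimum *)

Section negative_minimum.
Context {R : realType} (Psi : R -> R) (m : {measure set (measurableTypeR R) -> \bar R}).
Hypothesis mPsi : bernstein_measure Psi m.
Variables (d : nat) (d0 : (0 < d)%N).
Local Notation mu := (lebesgue_rV (R := R) d).
Local Notation j := (jump_kernel d m).
Local Notation eta := (@levy_weight R d).

Lemma Rintegral_even_part (h : 'rV[R]_d -> R) : mu.-integrable setT (EFin \o h) ->
  \int[mu]_z (h z + h (- z)) = 2 * \int[mu]_z h z.
Proof.
move=> Ih; have Ih' := integrable_preserving measure_preserving_opp Ih.
rewrite (RintegralD measurableT Ih Ih').
by rewrite (Rintegral_preserving measure_preserving_opp Ih); ring.
Qed.

(** When the increments of [f] at [x] are integrable against [j], symmetrizing them
  does not change their integral. *)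
Lemma Psi_laplacianE (f : 'rV[R]_d -> R) x :
  mu.-integrable setT (fun z => ((f (x + z) - f x) * j (enorm z))%:E) ->
  Psi_laplacian j f x = - \int[mu]_z ((f (x + z) - f x) * j (enorm z)).
Proof.
move=> If; rewrite /Psi_laplacian; congr (- _).
have := Rintegral_even_part If.
rewrite (_ : (fun z => (f (x + z) - f x) * j (enorm z) + _) =
    (fun z => (f (x + z) + f (x - z) - 2 * f x) * j (enorm z))).
  by move=> ->; field.
by apply/funext => z; rewrite enormN; ring.
Qed.

Variables (e : 'rV[R]_d) (lam : R) (Omega : set 'rV[R]_d) (c u : 'rV[R]_d -> R).
Hypothesis (e1 : enorm e = 1).
Hypothesis (oOmega : open Omega).
Hypothesis (OmegaH : Omega `<=` half_space e lam).
Hypothesis (anti_u : antisymmetric_wrt e lam u).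
Hypothesis (super_u : viscosity_supersolution j Omega c u).
Hypothesis u_ge0 : forall y, (half_space e lam `\` Omega) y -> 0 <= u y.

Lemma antisymmetric_hyperplane y : dotp y e = lam -> u y = 0.
Proof.
move=> ye; have := anti_u y.
have -> : reflection e lam y = y.
  by rewrite /reflection ye; apply/rowP => i; rewrite !mxE; ring.
by lra.
Qed.

Lemma ge0_closed_half_space y : lam <= dotp y e -> ~ Omega y -> 0 <= u y.
Proof.
rewrite le_eqVlt => /orP[/eqP ye _|ye Oy]; first by rewrite antisymmetric_hyperplane.
by apply: u_ge0; split.
Qed.

Definition sublevel (M : R) : set 'rV[R]_d := [set y | Omega y /\ u y < - (M / 2)].

Lemma open_sublevel M : open (sublevel M).
Proof.
have [[cu _] _] := super_u.
rewrite (_ : sublevel M = Omega `&` u @^-1` [set r | r < - (M / 2)])//.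
by apply: openI => //; apply: open_comp => // y _; exact: cu.
Qed.

Variables (x : 'rV[R]_d) (M : R).
Hypothesis Ox : Omega x.
Hypothesis M0 : 0 < M.
Hypothesis ux : u x = - M.
Hypothesis u_min : forall y, lam <= dotp y e -> - M <= u y.

Let E := sublevel M.
Let S : set 'rV[R]_d := ~` [set z | E (x + z)].

Let OH y : Omega y -> lam <= dotp y e.
Proof. by move=> /OmegaH /ltW. Qed.

Let mS : measurable S.
Proof.
apply: measurableC; rewrite (_ : [set _ | _] = [set z | E (z + x)]).
  by apply: measurable_preimage_shift; apply: open_measurable_rV; exact: open_sublevel.
by apply/seteqP; split => z /=; rewrite addrC.
Qed.

Section test_function.
Variables (q : R) (q0 : 0 < q) (q1 : q <= 1).
Hypothesis qE : forall y, eta (y - x) < q -> E y.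
Local Notation theta := (@cutoff R d q).

(* A competitor equal to [u] away from [x], flat near [x], and made strictly
   smaller than [u] by a small multiple of the weight. Its increments at [x] are
   of second order, which makes them integrable against [j]. *)
Let test (eps : R) (y : 'rV[R]_d) : R :=
  - M + theta (y - x) * (u y + M) - eps * eta (y - x).

Let test_x eps : test eps x = - M.
Proof.
by rewrite /test subrr levy_weight0 cutoff_eq0 ?levy_weight0 ?divr_ge0 ?ltW//; ring.
Qed.

Let cu : continuous u. Proof. by have [[]] := super_u. Qed.

Let test_Cb eps : 0 < eps -> Cb (test eps).
Proof.
move=> eps0; split.
  move=> y; have fy := nbhs_filter y.
  apply: (@cvgB _ _ _ _ fy).
    apply: (@cvgD _ _ _ _ fy); first exact: (@cvg_cst _ _ _ _ fy).
    apply: (@cvgM _ _ _ fy); first exact: continuous_cutoff.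
    by apply: (@cvgD _ _ _ _ fy); [exact: cu|exact: (@cvg_cst _ _ _ _ fy)].
  apply: (@cvgM _ _ _ fy); first exact: (@cvg_cst _ _ _ _ fy).
  exact: continuous_levy_weight.
have [[_ /ex_strict_bound_gt0[B B0 uB]] _] := super_u.
have {}uB y : `|u y| <= B by exact/ltW/uB.
exists (M + (B + M) + eps); split; first exact: num_real.
move=> K /ltW BK y _; apply: le_trans BK.
have M0' := ltW M0.
rewrite /test; apply: (le_trans (ler_normB _ _)); apply: lerD.
  apply: (le_trans (ler_normD _ _)); rewrite normrN (ger0_norm M0') lerD2l normrM.
  rewrite ger0_norm ?cutoff_ge0// -[leRHS]mul1r ler_pM ?cutoff_ge0 ?cutoff_le1//.
  by apply: (le_trans (ler_normD _ _)); rewrite (ger0_norm M0') lerD2r.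
rewrite normrM (gtr0_norm eps0) ger0_norm ?levy_weight_ge0//.
by rewrite ler_piMr ?(ltW eps0)// /levy_weight ge_min lexx.
Qed.

Let test_C2 eps : C2_near (test eps) x.
Proof.
apply: (@C2_near_paraboloid _ _ _ _ (- M) eps [set y | eta (y - x) < q / 2]).
- rewrite (_ : mkset _ = (fun y : 'rV[R]_d => eta (y - x)) @^-1` [set r | r < q / 2])//.
  by apply: open_comp => // y _; exact: continuous_levy_weight.
- by rewrite /= subrr levy_weight0 divr_gt0.
move=> y /= yq; rewrite /test cutoff_eq0 ?(ltW yq)// mul0r addr0; congr (_ - _ * _).
have q21 : q / 2 < 1 by have := q1; lra.
move: yq; rewrite /levy_weight gt_min; case/orP => yq.
  by move: (lt_trans yq q21); rewrite ltxx.
by rewrite min_r// ltW// (lt_trans yq).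
Qed.

Let test_lt eps y : 0 < eps -> y != x -> test eps y < u y.
Proof.
move=> eps0 yx; have ey : 0 < eps * eta (y - x).
  by rewrite mulr_gt0// levy_weight_gt0// subr_eq0.
rewrite /test; have [yq|yq] := leP q (eta (y - x)).
  by rewrite cutoff_eq1//; lra.
have [Oy _] := qE yq.
have uM : 0 <= u y + M by have := u_min (OH Oy); lra.
have := ler_piMl uM (cutoff_le1 q (y - x)); lra.
Qed.

Let g (z : 'rV[R]_d) : R := theta z * (u (x + z) + M).

Let testE eps z : test eps (x + z) - test eps x = g z - eps * eta z.
Proof.
rewrite test_x /test /g (_ : x + z - x = z); first by ring.
by rewrite addrC addKr.
Qed.

Let measurable_theta : measurable_fun setT theta.
Proof.
apply: continuous_measurable_rV.
rewrite (_ : theta = (fun z : 'rV[R]_d => theta (z - 0))); first exact: continuous_cutoff.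
by apply/funext => z; rewrite subr0.
Qed.

Let measurable_g : measurable_fun setT g.
Proof.
apply: measurable_funM => //; apply: measurable_funD => //.
rewrite (_ : (fun z => _) = u \o (fun z => z + x)).
  apply: measurableT_comp; last exact: measurable_shift_rV.
  exact: continuous_measurable_rV.
by apply/funext => z; rewrite /= addrC.
Qed.

Let integrable_g : mu.-integrable setT (fun z => (g z * j (enorm z))%:E).
Proof.
have [[_ /ex_strict_bound_gt0[B B0 uB]] _] := super_u.
have {}uB y : `|u y| <= B by exact/ltW/uB.
apply: (integrable_jump_kernel mPsi (c := 2 / q * (B + M))) => // z.
rewrite normrM ger0_norm ?cutoff_ge0// mulrAC ler_pM ?cutoff_ge0 ?cutoff_le//.
by apply: (le_trans (ler_normD _ _)); rewrite (gtr0_norm M0) lerD2r.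
Qed.

Let integrable_eta : mu.-integrable setT (fun z => (eta z * j (enorm z))%:E).
Proof.
apply: (integrable_jump_kernel mPsi (c := 1)); first exact: measurable_levy_weight.
by move=> z; rewrite mul1r ger0_norm ?levy_weight_ge0.
Qed.

Let integrable_S : mu.-integrable setT (fun z => (\1_S z * j (enorm z))%:E).
Proof.
apply: (integrable_jump_kernel mPsi (c := q^-1)); first exact: measurable_indic.
move=> z; rewrite ger0_norm// indicE; case: (boolP (z \in S)) => [|_]; last first.
  by rewrite mulr_ge0 ?levy_weight_ge0// invr_ge0 ltW.
rewrite inE => zS; rewrite ler_pdivlMl// mulr1 leNgt; apply/negP => zq.
by apply: zS; apply: qE; rewrite addrC addKr.
Qed.

Let integral_g_le eps : 0 < eps ->
  \int[mu]_z (g z * j (enorm z)) <=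
    c^\- x * M + eps * \int[mu]_z (eta z * j (enorm z)).
Proof.
move=> eps0; have [_ /(_ x (test eps) Ox (test_Cb eps0) (test_C2 eps))] := super_u.
rewrite test_x ux => /(_ erefl (fun y => @test_lt eps y eps0)).
have Ieta : mu.-integrable setT (fun z => (eps * (eta z * j (enorm z)))%:E).
  under eq_fun do rewrite EFinM.
  exact: integrableZl.
have hE z : (test eps (x + z) - test eps x) * j (enorm z) =
    g z * j (enorm z) - eps * (eta z * j (enorm z)).
  by rewrite testE mulrBl mulrA.
rewrite Psi_laplacianE; last first.
  under eq_fun do rewrite hE EFinB.
  exact: integrableB.
under eq_Rintegral do rewrite hE.
rewrite RintegralB// RintegralZl//.
have cM : - c x * M <= c^\- x * M by rewrite ler_wpM2r ?(ltW M0)// /funrneg le_max lexx.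
by lra.
Qed.

(* On the mirror side [u] may be very negative, but this is compensated pairwise:
   for [y] in the half-space with mirror image [y'], [u y' = - u y], and [j] is
   larger at [y - x] than at [y' - x], so that the contributions of [y] and [y']
   sum to something nonnegative. *)
Let integral_S_le_g :
  M / 2 * \int[mu]_z (\1_S z * j (enorm z)) <= \int[mu]_z (g z * j (enorm z)).
Proof.
have IS : mu.-integrable setT (fun z => (M / 2 * (\1_S z * j (enorm z)))%:E).
  under eq_fun do rewrite EFinM.
  exact: integrableZl.
rewrite -RintegralZl// -subr_ge0 -RintegralB//.
apply: (Rintegral_ge0_symmetrization (measure_preserving_reflection lam e1 x)).
  rewrite /comp; under eq_fun do rewrite EFinB.
  exact: integrableB.
have SE z : \1_S z = (~~ `[< E (x + z) >])%:R :> R.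
  by rewrite indicE; congr (_%:R); rewrite in_setC; congr (~~ _); apply/idP/idP => /[!inE]/= /asboolP.
have gS z : ~ E (x + z) -> g z = u (x + z) + M.
  move=> Ez; rewrite /g cutoff_eq1 ?mul1r// leNgt; apply/negP => zq.
  by apply: Ez; apply: qE; rewrite addrC addKr.
have key y : lam <= dotp y e ->
    0 <= (g (y - x) * j (enorm (y - x)) - M / 2 * (\1_S (y - x) * j (enorm (y - x)))) +
      (g (reflection e lam y - x) * j (enorm (reflection e lam y - x)) -
       M / 2 * (\1_S (reflection e lam y - x) * j (enorm (reflection e lam y - x)))).
  have hM := M0; move=> ye; set y' := reflection e lam y.
  have y'e : dotp y' e <= lam by rewrite dotp_reflection//; lra.
  have y'E : ~ E y' by move=> [/OmegaH]; rewrite /half_space/= ltNge y'e.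
  have uy' : u y' = - u y by rewrite [in RHS]anti_u opprK.
  have yx' : x + (y' - x) = y' by rewrite addrC subrK.
  have yx : x + (y - x) = y by rewrite addrC subrK.
  have Ex : E x by split => //; rewrite ux; lra.
  have jj : ~ E y -> j (enorm (y' - x)) <= j (enorm (y - x)).
    move=> Ey; apply: (jump_kernel_anti mPsi d0).
      by rewrite enorm_gt0// subr_eq0; apply: contra_notN Ey => /eqP ->.
    by apply: enorm_sub_reflection => //; exact: OH.
  have uM : 0 <= u y + M by rewrite -lerBlDr sub0r; exact: u_min.
  have gy' : g (y' - x) = M - u y by rewrite gS yx' ?uy' 1?addrC.
  have Sy' : \1_S (y' - x) = 1 :> R by rewrite SE yx' asboolF.
  have gy : 0 <= g (y - x) by rewrite /g yx; apply: mulr_ge0; [exact: cutoff_ge0|exact: uM].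
  have gSy : ~ E y -> g (y - x) = u y + M by move=> Ey; rewrite gS yx.
  have Sy : \1_S (y - x) = (~~ `[< E y >])%:R :> R by rewrite SE yx.
  move: gy' Sy' gy gSy Sy; move: (g (y' - x)) (\1_S (y' - x)) (g (y - x)) (\1_S (y - x)).
  have j0' := jump_kernel_ge0 m d (enorm (y' - x)).
  have j0 := jump_kernel_ge0 m d (enorm (y - x)).
  move: j0' j0 jj; move: (j (enorm (y' - x))) (j (enorm (y - x))) => b a b0 a0 ba.
  move=> _ _ gy _ -> -> gy0 gyE ->; case: asboolP => [[_ uy]|Ey] /=.
    have h1 : 0 <= gy * a by exact: mulr_ge0.
    have h2 : 0 <= (M / 2 - u y) * b by apply: mulr_ge0; lra.
    by lra.
  have uy : - (M / 2) <= u y.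
    have [Oy|Oy] := pselect (Omega y).
      by rewrite leNgt; apply/negP => uy; apply: Ey.
    by have := ge0_closed_half_space ye Oy; lra.
  rewrite (gyE Ey); have ab := ba Ey.
  have h1 : 0 <= (u y + M / 2) * (a - b) by apply: mulr_ge0; lra.
  have h2 : 0 <= M * b by apply: mulr_ge0; rewrite ?(ltW M0).
  by lra.
move=> z; have [ze|/ltW ze] := leP lam (dotp (x + z) e).
  by have := key _ ze; rewrite (_ : x + z - x = z)// addrC addKr.
have ye : lam <= dotp (reflection e lam (x + z)) e by rewrite dotp_reflection//; lra.
have xz : x + z - x = z by rewrite addrC addKr.
have h := key _ ye; rewrite (reflectionK lam e1 (x + z)) xz in h.
by rewrite addrC; exact: h.
Qed.

Lemma cutoff_integral_le :
  (\int[mu]_(z in S) (j (enorm z))%:E <= (2 * c^\- x)%:E)%E.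
Proof.
have -> : (\int[mu]_(z in S) (j (enorm z))%:E = \int[mu]_z (\1_S z * j (enorm z))%:E)%E.
  rewrite [LHS]integral_mkcond; apply: eq_integral => z _.
  by rewrite patchE indicE; case: ifP; rewrite ?mul1r ?mul0r.
rewrite -(fineK (integrable_fin_num _ integrable_S))// lee_fin.
rewrite -[fine _]/(\int[mu]_z (\1_S z * j (enorm z)))%R.
have h : M / 2 * \int[mu]_z (\1_S z * j (enorm z)) <= c^\- x * M.
  apply: (le_trans integral_S_le_g).
  have N0 : 0 <= \int[mu]_z (eta z * j (enorm z)).
    by apply: Rintegral_ge0 => z _; rewrite mulr_ge0 ?levy_weight_ge0 ?jump_kernel_ge0.
  set N := \int[mu]_z (eta z * j (enorm z)) in N0.
  apply/ler_addgt0Pr => eps eps0.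
  have N1 : 0 < N + 1 by lra.
  have := integral_g_le (divr_gt0 eps0 N1); rewrite -/N => /le_trans; apply.
  by rewrite lerD2l mulrAC ler_pdivrMr// ler_wpM2l ?(ltW eps0)//; lra.
by rewrite -(ler_pM2l M0); lra.
Qed.

End test_function.

(** At a negative minimum [- M] over the half-space, every jump leaving the set
  where [u < - M / 2] contributes at least [M / 2] to the operator, in the average
  over mirror pairs; the equation bounds the total by [c^\- x * M]. *)
Lemma nonlocal_minimum_principle :
  (\int[mu]_(z in ~` [set z | sublevel M (x + z)%R]) (j (enorm z))%:E <=
    (2 * c^\- x)%:E)%E.
Proof.
have Ex : sublevel M x by split => //; rewrite ux; have := M0; lra.
have [q [q0 q1 qE]] := levy_weight_nbhs (open_sublevel (M := M)) Ex.
exact: cutoff_integral_le q0 q1 qE.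
Qed.

End negative_minimum.

(** * Norms over a bounded domain *)

Section domain.
Context {R : realType} {d : nat}.
Local Notation mu := (lebesgue_rV (R := R) d).
Implicit Types (Omega : set 'rV[R]_d) (x y z : 'rV[R]_d).

Lemma enorm_le_diameter Omega x y : bounded_set Omega -> Omega x -> Omega y ->
  enorm (x - y) <= diameter Omega.
Proof.
move=> /ex_strict_bound_gt0[B B0 OB] Ox Oy; apply: ub_le_sup; last by exists x => //; exists y.
have {}OB z : Omega z -> `|z| <= B by move=> /OB /ltW.
exists (Num.sqrt (\sum_(i < d) (2 * B) ^+ 2)) => _ [a Oa [b Ob <-]].
apply: ler_wsqrtr; apply: ler_sum => i _.
rewrite -expr2 -real_normK ?num_real// lerXn2r ?nnegrE ?mulr_ge0 ?(ltW B0)//.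
apply: (le_trans (coord_le_mx_norm _ _)); apply: (le_trans (ler_normB _ _)).
by rewrite mulr2n mulrDl mul1r lerD// OB.
Qed.

Lemma sup_image_le (A : set 'rV[R]_d) (f : 'rV[R]_d -> R) (M : R) : 0 <= M ->
  (forall x, A x -> f x <= M) -> sup [set f x | x in A] <= M.
Proof.
move=> M0 fM; have [->|/set0P[x Ax]] := eqVneq A set0; first by rewrite image_set0 sup0.
by apply: ge_sup; [exists (f x), x|move=> _ [y Ay <-]; exact: fM].
Qed.

Lemma le_Linfty_norm (A : set 'rV[R]_d) (c : 'rV[R]_d -> R) x :
  [bounded c x | x in A] -> A x -> c^\- x <= Linfty_norm A c^\-.
Proof.
move=> /ex_strict_bound_gt0[B B0 cB] Ax; apply: (le_trans (ler_norm _)).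
apply: ub_le_sup; last by exists x.
exists B => _ [y Ay <-].
have cy : `|c y| <= B by exact/ltW/cB.
rewrite ger0_norm ?funrneg_ge0//; apply: le_trans cy.
by rewrite /funrneg ge_max -normrN ler_norm normrN normr_ge0.
Qed.

Lemma Linfty_norm_ge0 (A : set 'rV[R]_d) (c : 'rV[R]_d -> R) :
  [bounded c x | x in A] -> 0 <= Linfty_norm A c^\-.
Proof.
move=> bc; have [A0|/set0P[x Ax]] := eqVneq A set0.
  by rewrite /Linfty_norm A0 image_set0 sup0.
by apply: le_trans (le_Linfty_norm bc Ax); exact: funrneg_ge0.
Qed.

(** Chebyshev's inequality. *)
Lemma Lp_norm_ge (A S : set 'rV[R]_d) (p a V : R) (f : 'rV[R]_d -> R) :
  0 < p -> 0 <= a -> 0 <= V -> measurable A -> measurable S -> S `<=` A ->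
  measurable_fun setT f -> (forall x, S x -> a <= f x) -> mu S = V%:E ->
  ((a * V `^ p^-1)%:E <= Lp_norm A p f)%E.
Proof.
move=> p0 a0 V0 mA mS SA mf af muS.
have -> : (a * V `^ p^-1)%:E = ((a `^ p * V)%:E `^ p^-1)%E.
  by rewrite poweR_EFin powRM ?powR_ge0// -powRrM mulfV ?gt_eqF// powRr1.
rewrite /Lp_norm unlock.
have I0 : (0 <= \int[mu]_x (`|(f x * \1_A x)%:E| `^ p))%E.
  by apply: integral_ge0 => x _; exact: poweR_ge0.
apply: gt0_ler_poweR; rewrite ?invr_ge0 ?(ltW p0)//.
- by rewrite in_itv/= leey lee_fin mulr_ge0 ?powR_ge0.
- by rewrite in_itv/= leey andbT.
rewrite EFinM -muS -(setIT S) -integral_indic// -ge0_integralZl//; last 2 first.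
- by apply/measurable_EFinP; exact: measurable_indic.
- by rewrite lee_fin powR_ge0.
apply: ge0_le_integral => //.
- by move=> x _; rewrite -EFinM lee_fin mulr_ge0// powR_ge0.
- by apply: emeasurable_funM => //; apply/measurable_EFinP; exact: measurable_indic.
- under eq_fun do rewrite abse_EFin poweR_EFin.
  apply/measurable_EFinP; apply: (@measurableT_comp _ _ _ _ _ _ (@powR R ^~ p)) => //.
  by apply: measurableT_comp => //; apply: measurable_funM => //; exact: measurable_indic.
move=> x _; rewrite -EFinM abse_EFin poweR_EFin lee_fin indicE.
case: (boolP (x \in S)) => [|_]; last by rewrite mulr0 powR_ge0.
rewrite inE => Sx; rewrite mulr1 indicE mem_set; last exact: SA.
rewrite mulr1 ger0_norm; last exact: le_trans (af _ Sx).
by apply: ge0_ler_powR; rewrite ?nnegrE ?(ltW p0)// ?(le_trans a0) ?af.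
Qed.

End domain.

(** * The maximum principle *)

Lemma closure_le {R : realType} {n : nat} (A : set 'rV[R]_n) (f : 'rV[R]_n -> R) (a : R) :
  continuous f -> (forall x, A x -> f x <= a) -> forall x, closure A x -> f x <= a.
Proof.
move=> cf fa.
have cB : closed [set x | f x <= a].
  by apply: (@closed_comp _ _ f [set r | r <= a]) => [y _|]; [exact: cf|exact: closed_le].
by move=> x /(closure_subset (B := [set x | f x <= a]) fa); rewrite -(closure_id _).1.
Qed.

Section half_space_problem.
Context {R : realType} (Psi : R -> R) (m : {measure set (measurableTypeR R) -> \bar R}).
Hypothesis mPsi : bernstein_measure Psi m.
Variable d : nat.
Hypothesis d2 : (2 <= d)%N.
Local Notation mu := (lebesgue_rV (R := R) d).
Local Notation j := (jump_kernel d m).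

Section one_domain.
Variables (e : 'rV[R]_d) (lam : R) (Omega : set 'rV[R]_d) (c u : 'rV[R]_d -> R).
Hypothesis (e1 : enorm e = 1).
Hypothesis (oOmega : open Omega).
Hypothesis (bOmega : bounded_set Omega).
Hypothesis (OmegaH : Omega `<=` half_space e lam).
Hypothesis (anti_u : antisymmetric_wrt e lam u).
Hypothesis (super_u : viscosity_supersolution j Omega c u).
Hypothesis u_ge0 : forall y, (half_space e lam `\` Omega) y -> 0 <= u y.

Definition negative_minimum (x : 'rV[R]_d) (M : R) :=
  [/\ Omega x, 0 < M, u x = - M & forall y, lam <= dotp y e -> - M <= u y].

(** The minimum of [u] over the compact closure of [Omega] cannot be negative at a
  point outside [Omega]: there [u] is nonnegative, or vanishes by antisymmetry if
  the point lies on the hyperplane. *)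
Lemma nonneg_or_negative_minimum :
  (forall y, Omega y -> 0 <= u y) \/ exists x M, negative_minimum x M.
Proof.
have [|/existsNP[y0 /not_implyP[Oy0 /negP]]] :=
  pselect (forall y, Omega y -> 0 <= u y); first by left.
rewrite -ltNge => uy0; right.
have [[cu _] _] := super_u.
have bC : bounded_set (closure Omega).
  have [B B0 OB] := ex_strict_bound_gt0 bOmega.
  have {}OB z : Omega z -> `|z| <= B by move=> /OB /ltW.
  exists B; split; first exact: num_real.
  move=> K /ltW BK z zO; apply: le_trans BK.
  by apply: closure_le zO => //; exact: norm_continuous.
have C0 : closure Omega !=set0 by exists y0; exact: subset_closure.
have [x xC xmin] := EVT_min_rV C0
  (bounded_closed_compact bC (@closed_closure _ Omega)) (continuous_subspaceT cu).
have ux : u x < 0.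
  by apply: le_lt_trans uy0; apply: xmin; rewrite inE; exact: subset_closure.
have xe : lam <= dotp x e.
  move: xC; rewrite inE => xC; rewrite -lerN2.
  apply: (closure_le (f := fun z => - dotp z e)) xC => [z|z /OmegaH /ltW].
    by apply: (@cvgN _ _ _ _ (nbhs_filter z)); exact: continuous_dotpl.
  by rewrite lerN2.
exists x, (- u x); split; rewrite ?opprK ?oppr_gt0//.
  apply: contrapT => Ox.
  by have := ge0_closed_half_space anti_u u_ge0 xe Ox; rewrite leNgt ux.
move=> y ye; have [Oy|Oy] := pselect (Omega y).
  by apply: xmin; rewrite inE; exact: subset_closure.
by apply: (le_trans (ltW ux)); exact: (ge0_closed_half_space anti_u u_ge0).
Qed.

(** The minimum principle bounds from above, and [tail] from below, the mass of the
  jumps out of the sublevel set. *)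
Lemma negative_minimum_bound (p K : R) x M V :
  (forall (E : set 'rV[R]_d) V, measurable E -> 0 < V -> (mu E <= V%:E)%E ->
    (forall z, E z -> enorm z <= diameter Omega) ->
    (1 <= (K * V `^ p^-1)%:E * \int[mu]_(z in ~` E) jump m d (enorm z))%E) ->
  0 < K -> negative_minimum x M -> 0 < V -> (mu (sublevel Omega u M) <= V%:E)%E ->
  1 <= 2 * K * c^\- x * V `^ p^-1.
Proof.
move=> tail K0 [Ox M0 ux umin] V0 EV.
pose E := [set z | sublevel Omega u M (x + z)].
have oE := open_sublevel (M := M) oOmega super_u.
have EE : E = [set z | sublevel Omega u M (z + x)].
  by apply/seteqP; split => z /=; rewrite /E/= addrC.
have mE : measurable E.
  by rewrite EE; apply: measurable_preimage_shift; exact: open_measurable_rV.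
have muE : mu E = mu (sublevel Omega u M).
  by rewrite EE lebesgue_rV_translation//; exact: open_measurable_rV.
have ED z : E z -> enorm z <= diameter Omega.
  move=> [Oxz _]; rewrite (_ : z = x + z - x); last by rewrite addrC addKr.
  exact: enorm_le_diameter.
have := tail E V mE V0; rewrite muE => /(_ EV ED).
rewrite -(integral_jump_kernel mPsi); last 2 first.
- exact: measurableC.
- by apply; rewrite /E/= addr0; split => //; rewrite ux; lra.
have := nonlocal_minimum_principle mPsi (ltnW d2) e1 oOmega OmegaH anti_u super_u
  u_ge0 Ox M0 ux umin.
rewrite -/E => le2c /le_trans h.
have KV : 0 <= K * V `^ p^-1 by rewrite mulr_ge0 ?powR_ge0// ltW.
have := h _ (lee_wpmul2l (x := (K * V `^ p^-1)%:E) _ le2c).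
rewrite lee_fin => /(_ KV); rewrite -EFinM lee_fin => /le_trans; apply.
by rewrite [leLHS](_ : _ = 2 * K * c^\- x * V `^ p^-1)//; ring.
Qed.

Lemma sublevel_finite x M : negative_minimum x M ->
  (mu (sublevel Omega u M) < +oo)%E.
Proof.
move=> [Ox M0 ux umin]; have [B B0 OB] := ex_strict_bound_gt0 bOmega.
have {}OB z : Omega z -> `|z| <= B by move=> /OB /ltW.
pose I := `[- B, B]%classic : set R.
apply: (@le_lt_trans _ _ (mu [set z | forall i, I (z ord0 i)])).
  apply: le_measure; rewrite ?inE.
  - by apply: open_measurable_rV; exact: (open_sublevel oOmega super_u).
  - by apply: (@measurable_box _ _ (fun=> I)) => i; exact: measurable_itv.
  - move=> z [Oz _] i; rewrite /I/= in_itv/= -ler_norml.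
    exact: le_trans (coord_le_mx_norm z i) (OB _ Oz).
rewrite (@lebesgue_rV_box _ _ (fun=> I)); last by move=> i; exact: measurable_itv.
rewrite -ge0_fin_numE ?prode_ge0// prode_fin_num// => i _.
by rewrite lebesgue_measure_itv/=; case: ifP.
Qed.

End one_domain.
End half_space_problem.

Theorem theorem3p1 (R : realType) (d : nat) (hd : (2 <= d)%N)
    (Psi : R -> R) (m : {measure set (measurableTypeR R) -> \bar R})
    (PsiB : bernstein Psi) (Psi0 : Psi x @[x --> 0^'+] --> 0)
    (Psim : bernstein_measure Psi m)
    (Psi_scaling : weak_scaling Psi)
    (j_decay : slow_decay (jump_kernel d m))
    (D : R) :
  (exists p C : R, [/\ 1 <= p, 0 < C &
    forall (e : 'rV[R]_d) (lam : R) (Omega : set 'rV[R]_d)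
           (c u : 'rV[R]_d -> R),
      enorm e = 1 ->
      open Omega -> bounded_set Omega -> Omega `<=` half_space e lam ->
      diameter Omega = D ->
      [bounded c x | x in Omega] ->
      antisymmetric_wrt e lam u ->
      viscosity_supersolution (jump_kernel d m) Omega c u ->
      (forall x, (half_space e lam `\` Omega) x -> 0 <= u x) ->
      ((sup [set (u^\- x)%R | x in Omega])%:E <=
        (C * Linfty_norm Omega (c^\-)%R)%:E * Lp_norm Omega p (u^\-)%R)%E]) /\
  (forall c_oo : R, 0 < c_oo -> exists2 delta : R, 0 < delta &
    forall (e : 'rV[R]_d) (lam : R) (Omega : set 'rV[R]_d)
           (c u : 'rV[R]_d -> R),
      enorm e = 1 ->
      open Omega -> bounded_set Omega -> Omega `<=` half_space e lam ->
      diameter Omega = D ->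
      [bounded c x | x in Omega] ->
      antisymmetric_wrt e lam u ->
      viscosity_supersolution (jump_kernel d m) Omega c u ->
      (forall x, (half_space e lam `\` Omega) x -> 0 <= u x) ->
      (forall x, Omega x -> c^\- x <= c_oo) ->
      (lebesgue_rV d Omega < delta%:E)%E ->
      forall x, Omega x -> 0 <= u x).
Proof.
have d0 : (0 < d)%N by exact: ltnW.
have [p [K [p1 K0 tail]]] := nonlocal_tail Psim D hd Psi_scaling.
have p0 : 0 < p by exact: lt_le_trans p1.
have powK (a : R) : 0 < a -> (a `^ p) `^ p^-1 = a.
  by move=> a0; rewrite -powRrM mulfV ?gt_eqF// powRr1// ltW.
split.
  exists p, (4 * K); split => //; first by rewrite mulr_gt0.
  move=> e lam Omega c u e1 oO bO OH diam bc anti super uge.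
  have L0 := Linfty_norm_ge0 bc.
  have rhs0 : (0 <= (4 * K * Linfty_norm Omega (c^\-)%R)%:E *
      Lp_norm Omega p (u^\-)%R)%E.
    by rewrite mule_ge0 ?Lnorm_ge0// lee_fin mulr_ge0// mulr_ge0// ltW.
  have [u0|[x [M negmin]]] :=
    nonneg_or_negative_minimum bO OH anti super uge.
    apply: le_trans rhs0; rewrite lee_fin; apply: sup_image_le => // y /u0 uy.
    by rewrite /funrneg ge_max lexx oppr_le0 uy.
  have [Ox M0 ux umin] := negmin.
  have supM : sup [set (u^\- x)%R | x in Omega] <= M.
    apply: sup_image_le; first exact: ltW.
    move=> y /OH /ltW /umin uy; rewrite /funrneg ge_max (ltW M0) andbT.
    by rewrite lerNl.
  have bnd V : 0 < V -> (lebesgue_rV d (sublevel Omega u M) <= V%:E)%E ->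
      1 <= 2 * K * c^\- x * V `^ p^-1.
    apply: (negative_minimum_bound Psim hd e1 oO bO OH anti super uge _ K0 negmin).
    by rewrite diam.
  have cx0 : 0 <= c^\- x by exact: funrneg_ge0.
  have Kc0 : 0 <= 2 * K * c^\- x by rewrite !mulr_ge0// ltW.
  have finE := sublevel_finite oO bO super negmin.
  pose V := fine (lebesgue_rV d (sublevel Omega u M)).
  have EV : lebesgue_rV d (sublevel Omega u M) = V%:E.
    by rewrite fineK// ge0_fin_numE.
  have V0 : 0 < V.
    rewrite lt_neqAle fine_ge0// andbT; apply/eqP => V0.
    (* a null sublevel set would satisfy the bound for arbitrarily small [V] *)
    pose a := (2 * K * c^\- x + 1)^-1.
    have a0 : 0 < a by rewrite invr_gt0; lra.
    have := bnd (a `^ p); rewrite powR_gt0// powK// EV -V0 lee_fin powR_ge0.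
    move=> /(_ isT isT); rewrite /a ler_pdivlMr; lra.
  have oE := open_sublevel (M := M) oO super.
  have Lp : ((M / 2 * V `^ p^-1)%:E <= Lp_norm Omega p (u^\-)%R)%E.
    apply: (Lp_norm_ge (S := sublevel Omega u M)) => //.
    - by rewrite divr_ge0// ltW.
    - exact: ltW.
    - exact: open_measurable_rV.
    - exact: open_measurable_rV.
    - by move=> y [].
    - apply: measurable_funrneg; apply: continuous_measurable_rV.
      by have [[]] := super.
    - by move=> y [_ uy]; rewrite /funrneg le_max lerNr ltW.
  apply: (@le_trans _ _ M%:E); first by rewrite lee_fin.
  apply: (@le_trans _ _ ((4 * K * Linfty_norm Omega (c^\-)%R)%:E *
    (M / 2 * V `^ p^-1)%:E)%E); last first.
    by apply: lee_wpmul2l => //; rewrite lee_fin mulr_ge0// mulr_ge0// ltW.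
  rewrite -EFinM lee_fin.
  have cL := le_Linfty_norm bc Ox.
  apply: (@le_trans _ _ (M * (2 * K * c^\- x * V `^ p^-1))).
    by rewrite ler_peMr ?(ltW M0)// bnd// EV.
  have -> : 4 * K * Linfty_norm Omega (c^\-)%R * (M / 2 * V `^ p^-1) =
      M * (2 * K * Linfty_norm Omega (c^\-)%R * V `^ p^-1) by field.
  rewrite ler_wpM2l ?(ltW M0)// ler_wpM2r ?powR_ge0// ler_wpM2l// mulr_ge0//.
  exact: ltW.
move=> c_oo coo0; pose a := (4 * K * c_oo)^-1.
have a0 : 0 < a by rewrite invr_gt0 !mulr_gt0.
exists (a `^ p); first exact: powR_gt0.
move=> e lam Omega c u e1 oO bO OH diam bc anti super uge cle Od.
have [//|[x [M negmin]]] := nonneg_or_negative_minimum bO OH anti super uge.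
have [Ox M0 ux umin] := negmin.
have oE := open_sublevel (M := M) oO super.
have : 1 <= 2 * K * c^\- x * (a `^ p) `^ p^-1.
  apply: (negative_minimum_bound Psim hd e1 oO bO OH anti super uge _ K0 negmin).
  - by rewrite diam.
  - exact: powR_gt0.
  apply: le_trans (ltW Od); apply: le_measure; rewrite ?inE.
  - exact: open_measurable_rV.
  - exact: open_measurable_rV.
  - by move=> y [].
rewrite powK// => h; exfalso.
have : 2 * K * c^\- x * a <= 2 * K * c_oo * a.
  by rewrite ler_wpM2r ?(ltW a0)// ler_wpM2l ?cle// mulr_ge0// ltW.
have -> : 2 * K * c_oo * a = 2^-1 by rewrite /a; field; rewrite !gt_eqF.
by move: h; lra.
Qed.
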